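(* Let $A$ be an automorphism of $\mathbb{P}^2(\mathbb{C})$ whose coefficients are algebraically independent over $\mathbb{Q}$. Then the set of periodic points of $A\sigma$ is Zariski dense in $\mathbb{P}^2(\mathbb{C})$.
   Context: $\sigma=(x_1x_2:x_0x_2:x_0x_1)$ is the standard Cremona involution of $\mathbb{P}^2(\mathbb{C})$. An automorphism of $\mathbb{P}^2(\mathbb{C})$, i.e. an element of $\mathrm{PGL}_3(\mathbb{C})$, has coefficients algebraically independent over $\mathbb{Q}$ if it has a representative in $\mathrm{GL}_3(\mathbb{C})$ whose nine entries are algebraically independent over $\mathbb{Q}$. For a birational map $f$ of $\mathbb{P}^2(\mathbb{C})$, $\mathrm{Ind}\,f$ denotes its finite set of indeterminacy points. A periodic point of $f$ is a point $p$ such that all germs of $f^n$ at $p$ ($n\ge 0$) are holomorphic and $\{p,f(p),f^2(p),\ldots\}$ is a finite set which does not meet $\mathrm{Ind}\,f\cup\mathrm{Ind}\,f^{-1}$. *)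

(* Defs.v *)
From HB Require Import structures.
From mathcomp Require Import all_boot all_order all_algebra.
From mathcomp Require Import complex mpoly.
From mathcomp Require Import all_classical all_reals.
From mathcomp Require Import topology normedtype derive.

Set Implicit Arguments.
Unset Strict Implicit.
Unset Printing Implicit Defensive.

Import Order.TTheory GRing.Theory Num.Theory.
Import numFieldNormedType.Exports.

Local Open Scope classical_set_scope.
Local Open Scope ring_scope.

Definition alg_indep_over_Q (C : numFieldType) (n : nat) (x : 'I_n -> C) : Prop :=
  forall q : {mpoly rat[n]}, mmap ratr x q = 0 -> q = 0.

(* [A] is an arbitrary representative of an element of PGL_3; some nonzero
   multiple of it must have independent entries. *)
Definition alg_indep_coefficients (C : numFieldType) (A : 'M[C]_3) : Prop :=
  exists2 c : C, c != 0 & alg_indep_over_Q (fun k => mxvec (c *: A) 0 k).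

(* Points of the projective plane are the lines through the origin of C^3. *)
Definition P2 (C : fieldType) : Type :=
  {L : {vspace 'cV[C]_3} | \dim L == 1%N}.

Definition hcoord (C : fieldType) (p : P2 C) (v : 'cV[C]_3) : Prop :=
  v != 0 /\ v \in val p.

Definition eval3 (C : fieldType) (F : {mpoly C[3]}) (v : 'cV[C]_3) : C :=
  F.@[fun i => v i 0].

Definition homogeneous (C : fieldType) (d : nat) (F : {mpoly C[3]}) : Prop :=
  F \is d.-homog.

Definition zero_locus (C : fieldType) (S : set {mpoly C[3]}) : set (P2 C) :=
  [set p | forall F, S F -> forall v, hcoord p v -> eval3 F v = 0].

Definition zariski_closed (C : fieldType) (Z : set (P2 C)) : Prop :=
  exists2 S : set {mpoly C[3]},
    (forall F, S F -> exists d, homogeneous d F) & Z = zero_locus S.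

Definition zariski_dense (C : fieldType) (X : set (P2 C)) : Prop :=
  forall Z : set (P2 C), zariski_closed Z -> X `<=` Z -> Z = setT.

(* The triple (F_0, F_1, F_2) stands for x |-> (F_0(x) : F_1(x) : F_2(x)).  It
   defines a rational map of the plane only under [rational_map], and common
   factors are allowed: two triples define the same map when [same_map] holds. *)
Definition triple (C : fieldType) : Type := 3.-tuple {mpoly C[3]}.

Definition rational_map (C : fieldType) (F : triple C) : Prop :=
  (exists d, forall i, homogeneous d (tnth F i)) /\ (exists i, tnth F i != 0).

Definition same_map (C : fieldType) (F G : triple C) : Prop :=
  forall i j, tnth F i * tnth G j = tnth F j * tnth G i.

Definition id_map (C : fieldType) : triple C := [tuple 'X_i | i < 3].

Definition comp_map (C : fieldType) (F G : triple C) : triple C :=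
  [tuple tnth F i \mPo G | i < 3].

Definition iter_map (C : fieldType) (n : nat) (F : triple C) : triple C :=
  iter n (comp_map F) (id_map C).

Definition inverse_maps (C : fieldType) (F G : triple C) : Prop :=
  [/\ rational_map F, rational_map G,
      rational_map (comp_map F G) /\ same_map (comp_map F G) (id_map C)
    & rational_map (comp_map G F) /\ same_map (comp_map G F) (id_map C)].

(* Points at which every triple defining the same rational map as F vanishes. *)
Definition Ind (C : fieldType) (F : triple C) : set (P2 C) :=
  [set p | forall G : triple C, rational_map G -> same_map F G ->
     forall v, hcoord p v -> forall i, eval3 (tnth G i) v = 0].

(* The germ at p of the rational map F is holomorphic and takes the value q.
   A holomorphic germ (P^2, p) -> (P^2, q) lifts to a holomorphic germ h of
   C^3 \ {0}, which must be proportional to F near v.  Differentiability is over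
   the scalars C. *)
Definition holomorphic_germ (C : numFieldType) (F : triple C) (p q : P2 C) : Prop :=
  exists (v : 'cV[C]_3) (h : 'cV[C]_3 -> 'cV[C]_3),
    [/\ hcoord p v, hcoord q (h v),
        (\forall w \near v, differentiable h w)
      & (\forall w \near v, forall i j,
           h w i 0 * eval3 (tnth F j) w = h w j 0 * eval3 (tnth F i) w)].

(* The point [o n] is f^n(p), for f the birational map defined by F.  Its
   inverse G is unique up to [same_map], and [Ind] is invariant under it. *)
Definition periodic_point (C : numFieldType) (F : triple C) (p : P2 C) : Prop :=
  exists2 G : triple C, inverse_maps F G &
  exists o : nat -> P2 C,
    [/\ (forall n, holomorphic_germ (iter_map n F) p (o n)),
        finite_set (range o)
      & range o `&` (Ind F `|` Ind G) = set0].

Definition linear_map (C : fieldType) (A : 'M[C]_3) : triple C :=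
  [tuple \sum_(j < 3) A i j *: 'X_j | i < 3].

Definition cremona (C : fieldType) : triple C :=
  let x (i : nat) : {mpoly C[3]} := 'X_(inord i) in
  [tuple x 1%N * x 2%N; x 0%N * x 2%N; x 0%N * x 1%N].

(* Main.v *)
(* Write f = A sigma and call a vector torus-periodic when its line is periodic under f
   and its orbit avoids the coordinate triangle.  Let J be the ideal of the forms that
   vanish on all these vectors.  It is stable under composition with f and with its
   inverse, so its zero set Z contains the forward f-orbit and the backward f-orbit of
   each of its points.  If there are infinitely many torus-periodic lines, then Z meets
   the line x_0 = 0, which f contracts to the point A e_0; hence Z contains A e_0, e_1 or
   e_2, and with it a whole forward orbit of A e_0 or a whole backward orbit of e_1 or e_2.
   For generic A none of these orbits lies on a curve: this is a polynomial condition on A,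
   and it holds for a product of two Moebius maps.  So J = 0.

   A generic A has a torus-periodic point of every period N: by elimination this is a
   constructible condition on A with rational coefficients, so it suffices to verify it
   on a nonempty open set of real matrices.  Near a suitable degenerate matrix the cycle
   equations become a small perturbation of a decoupled system, solved by contraction. *)
Require Import Defs.
From mathcomp Require Import all_boot all_order all_algebra fingroup perm.
From mathcomp Require Import complex mpoly zify ring lra.
From mathcomp Require Import all_classical all_reals.
From mathcomp Require Import topology normedtype derive.

Set Implicit Arguments.
Unset Strict Implicit.
Unset Printing Implicit Defensive.

Import Order.TTheory GRing.Theory Num.Theory.
Import numFieldNormedType.Exports.

Local Open Scope ring_scope.

(** * Constructible sets and elimination of a variable *)

Section FunctionRings.
Variable C : comNzRingType.

(** Linear algebra replaces dimension theory. If J had no zero on x_0 = 0, its restrictions to that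
    line would contain 1. This yields integral equations for the affine coordinates y and z, so
    finitely many monomials span all functions on the affine part of Z, which is then finite. Hence
    arbitrarily many periodic lines suffice, and one cycle of exact period N supplies N of them.

    The inverse sigma A^-1 is conjugate to A^-1 sigma, and the adjugate of a generic matrix is
    generic, so a single density statement serves forward and backward orbits.

    A nonzero form with prescribed monomials vanishes on an orbit iff all maximal minors of the
    table of monomial values vanish. These minors are integer polynomials in the entries of A, so
    one good matrix settles all generic ones. The Moebius multipliers 2 and 3 are multiplicatively
    independent, which makes the model orbit dense.

    Cycles are sought over the reals, where contraction is elementary; a real box is still Zariski
    dense among complex matrices. *)

Definition fun_ring (T : Type) (P : (T -> C) -> Prop) : Prop :=
  [/\ P (fun=> 1),
      forall f g, P f -> P g -> P (fun t => f t - g t)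
    & forall f g, P f -> P g -> P (fun t => f t * g t)].

Section Closure.
Variables (T : Type) (P : (T -> C) -> Prop) (PR : fun_ring P).

Lemma fun_ring1 : P (fun=> 1). Proof. by case: PR. Qed.
Lemma fun_ringB f g : P f -> P g -> P (fun t => f t - g t).
Proof. by case: PR => _ + _; apply. Qed.
Lemma fun_ringM f g : P f -> P g -> P (fun t => f t * g t).
Proof. by case: PR => _ _; apply. Qed.
Lemma fun_ring0 : P (fun=> 0).
Proof.
have := fun_ringB fun_ring1 fun_ring1.
by congr (P _); apply/funext => t; rewrite subrr.
Qed.
Lemma fun_ringN f : P f -> P (fun t => - f t).
Proof.
move=> Pf; have := fun_ringB fun_ring0 Pf.
by congr (P _); apply/funext => t; rewrite sub0r.
Qed.
Lemma fun_ringD f g : P f -> P g -> P (fun t => f t + g t).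
Proof.
move=> Pf Pg; have := fun_ringB Pf (fun_ringN Pg).
by congr (P _); apply/funext => t; rewrite opprK.
Qed.
Lemma fun_ring_sum I (r : seq I) (Q : pred I) F :
  (forall i, P (F i)) -> P (fun t => \sum_(i <- r | Q i) F i t).
Proof.
move=> PF; elim: r => [|i r IH].
  by have := fun_ring0; congr (P _); apply/funext => t; rewrite big_nil.
have [Qi|nQi] := boolP (Q i).
  have := fun_ringD (PF i) IH; congr (P _); apply/funext => t.
  by rewrite big_cons Qi.
by have := IH; congr (P _); apply/funext => t; rewrite big_cons (negbTE nQi).
Qed.
Lemma fun_ring_prod I (r : seq I) (Q : pred I) F :
  (forall i, P (F i)) -> P (fun t => \prod_(i <- r | Q i) F i t).
Proof.
move=> PF; elim: r => [|i r IH].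
  by have := fun_ring1; congr (P _); apply/funext => t; rewrite big_nil.
have [Qi|nQi] := boolP (Q i).
  have := fun_ringM (PF i) IH; congr (P _); apply/funext => t.
  by rewrite big_cons Qi.
by have := IH; congr (P _); apply/funext => t; rewrite big_cons (negbTE nQi).
Qed.
Lemma fun_ringX f n : P f -> P (fun t => f t ^+ n).
Proof.
move=> Pf; elim: n => [|n IH].
  by have := fun_ring1; congr (P _); apply/funext => t.
by have := fun_ringM Pf IH; congr (P _); apply/funext => t; rewrite exprS.
Qed.
End Closure.

(** The size bound does not depend on [t], although the leading coefficient may vanish at some [t];
    elimination runs on this formal size. *)
Definition uniform_poly (T : Type) (P : (T -> C) -> Prop) (n : nat)
    (G : T -> {poly C}) : Prop :=
  (forall t, (size (G t) <= n)%N) /\ (forall i, P (fun t => (G t)`_i)).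

(** Adjoins one variable to a ring of functions. Iterated, it gives polynomials in several variables
    without a multivariate calculus. *)
Definition poly_ring (T : Type) (P : (T -> C) -> Prop) (g : T * C -> C) : Prop :=
  exists n G, uniform_poly P n G /\ forall t x, g (t, x) = (G t).[x].

Section Uniform.
Variables (T : Type) (P : (T -> C) -> Prop) (PR : fun_ring P).

Lemma uniform_polyC f : P f -> uniform_poly P 1 (fun t => (f t)%:P).
Proof.
move=> Pf; split=> [t|i]; first exact: size_polyC_leq1.
case: i => [|i]; first by have := Pf; congr (P _); apply/funext=> t; rewrite coefC.
by have := fun_ring0 PR; congr (P _); apply/funext=> t; rewrite coefC.
Qed.

Lemma uniform_polyW n m G : (n <= m)%N -> uniform_poly P n G -> uniform_poly P m G.
Proof. by move=> nm [sG PG]; split=> // t; apply: leq_trans (sG t) nm. Qed.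

Lemma uniform_polyB n m G H : uniform_poly P n G -> uniform_poly P m H ->
  uniform_poly P (maxn n m) (fun t => G t - H t).
Proof.
move=> [sG PG] [sH PH]; split=> [t|i].
  rewrite (leq_trans (size_polyD _ _))// size_polyN geq_max !leq_max.
  by rewrite sG sH orbT.
have := fun_ringB PR (PG i) (PH i).
by congr (P _); apply/funext => t; rewrite coefB.
Qed.

Lemma uniform_polyM n m G H : uniform_poly P n G -> uniform_poly P m H ->
  uniform_poly P (n + m) (fun t => G t * H t).
Proof.
move=> [sG PG] [sH PH]; split=> [t|i].
  apply: leq_trans (size_polyMleq _ _) _; apply: leq_trans (leq_pred _) _.
  exact: leq_add.
have := @fun_ring_sum _ _ PR _ (index_enum 'I_i.+1) xpredT
  (fun j t => (G t)`_j * (H t)`_(i - j)) (fun j => fun_ringM PR (PG _) (PH _)).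
by congr (P _); apply/funext => t; rewrite coefM.
Qed.

Lemma uniform_polyXn k : uniform_poly P k.+1 (fun=> 'X^k).
Proof.
split=> [t|i]; first by rewrite size_polyXn.
case: (eqVneq i k) => [->|ik].
  by have := fun_ring1 PR; congr (P _); apply/funext=> t; rewrite coefXn eqxx.
by have := fun_ring0 PR; congr (P _); apply/funext=> t; rewrite coefXn (negbTE ik).
Qed.

Lemma uniform_polyX_exp n G k : uniform_poly P n G ->
  exists m, uniform_poly P m (fun t => G t ^+ k).
Proof.
move=> UG; elim: k => [|k [m IH]].
  by exists 1; have := uniform_polyC (fun_ring1 PR).
exists (n + m)%N; have := uniform_polyM UG IH; congr (uniform_poly _ _ _).
by apply/funext=> t; rewrite exprS.
Qed.

Lemma uniform_poly_trunc n G : uniform_poly P n.+1 G ->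
  uniform_poly P n (fun t => G t - ((G t)`_n)%:P * 'X^n).
Proof.
move=> UG; have [sG PG] := UG; split=> [t|i].
  apply/leq_sizeP => j nj; rewrite coefB coefCM coefXn.
  case: (eqVneq j n) => [->|jn]; first by rewrite mulr1 subrr.
  rewrite mulr0 subr0; apply/(leq_sizeP _ _ (sG t)).
  by rewrite ltn_neqAle eq_sym jn.
have [_] := uniform_polyB UG (uniform_polyM (uniform_polyC (PG n)) (uniform_polyXn n)).
exact.
Qed.

Lemma poly_ring_fun_ring : fun_ring (poly_ring P).
Proof.
split.
- exists 1%N, (fun=> 1%:P); split; first exact: (uniform_polyC (fun_ring1 PR)).
  by move=> t x; rewrite hornerC.
- move=> f g [n [G [UG fG]]] [m [H [UH gH]]].
  exists (maxn n m), (fun t => G t - H t); split; first exact: uniform_polyB.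
  by move=> t x; rewrite hornerD hornerN fG gH.
- move=> f g [n [G [UG fG]]] [m [H [UH gH]]].
  exists (n + m)%N, (fun t => G t * H t); split; first exact: uniform_polyM.
  by move=> t x; rewrite hornerM fG gH.
Qed.

Lemma poly_ring_base f : P f -> poly_ring P (fun tx => f tx.1).
Proof.
move=> Pf; exists 1%N, (fun t => (f t)%:P); split; first exact: uniform_polyC.
by move=> t x; rewrite hornerC.
Qed.

Lemma poly_ring_var : poly_ring P (fun tx => tx.2).
Proof.
exists 2%N, (fun=> 'X); split; last by move=> t x; rewrite hornerX.
by have := uniform_polyXn 1; rewrite expr1.
Qed.
End Uniform.
End FunctionRings.

(** * Chevalley's theorem for the projection along one coordinate *)

Section Constructible.
Variable C : closedFieldType.

Inductive constructible (T : Type) (P : (T -> C) -> Prop) : (T -> Prop) -> Prop :=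
| constructible_zero f : P f -> constructible P (fun t => f t = 0)
| constructibleN S : constructible P S -> constructible P (fun t => ~ S t)
| constructibleI S1 S2 : constructible P S1 -> constructible P S2 ->
    constructible P (fun t => S1 t /\ S2 t).

Section Basic.
Variables (T : Type) (P : (T -> C) -> Prop) (PR : fun_ring P).
Implicit Types S : T -> Prop.

Lemma constructible_ext S S' :
  (forall t, S t <-> S' t) -> constructible P S -> constructible P S'.
Proof. by move=> SS'; have -> : S = S' by apply/funext => t; apply/propext. Qed.

Lemma constructibleU S S' : constructible P S -> constructible P S' ->
  constructible P (fun t => S t \/ S' t).
Proof.
move=> cS cS'.
apply: constructible_ext (constructibleN (constructibleI (constructibleN cS) (constructibleN cS'))).
by move=> t; rewrite not_andP !notK.
Qed.

Lemma constructible_const (Q : Prop) : constructible P (fun=> Q).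
Proof.
have [q|nq] := pselect Q.
  by apply: constructible_ext (constructible_zero (fun_ring0 PR)).
apply: constructible_ext (constructibleN (constructible_zero (fun_ring0 PR))).
by move=> t; split=> // /(_ erefl).
Qed.

Lemma constructible_all (I : eqType) (r : seq I) (F : I -> T -> Prop) :
  (forall i, i \in r -> constructible P (F i)) ->
  constructible P (fun t => forall i, i \in r -> F i t).
Proof.
elim: r => [|i r IH] cF; first by apply: constructible_ext (constructible_const True).
have cr : constructible P (fun t => forall j, j \in r -> F j t).
  by apply: IH => j jr; apply: cF; rewrite inE jr orbT.
apply: constructible_ext (constructibleI (cF i (mem_head _ _)) cr) => t; split.
  by move=> [Fi Fr] j; rewrite inE => /predU1P[->//|/Fr].
by move=> F'; split; [exact/F'/mem_head|move=> j jr; apply: F'; rewrite inE jr orbT].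
Qed.

Lemma constructible_poly_neq0 n G : uniform_poly P n G ->
  constructible P (fun t => G t <> 0).
Proof.
move=> [sG PG]; apply: constructibleN.
have := @constructible_all _ (iota 0 n) (fun i t => (G t)`_i = 0)
  (fun i _ => constructible_zero (PG i)).
apply: constructible_ext => t; split=> [G0|-> i _]; last by rewrite coef0.
apply/polyP => i; rewrite coef0; have [ni|ni] := leqP n i.
  exact/(leq_sizeP _ _ (sG t)).
by apply: G0; rewrite mem_iota.
Qed.

(** One step of pseudo-division for formal degrees [n <= m]: the terms in X^m cancel without any
    division, so the coefficients stay in the ring. *)
Definition leading_reduction n m (G K : T -> {poly C}) (t : T) : {poly C} :=
  ((G t)`_n)%:P * K t - ((K t)`_m)%:P * 'X^(m - n) * G t.

Lemma uniform_leading_reduction n m G K : (n <= m)%N ->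
  uniform_poly P n.+1 G -> uniform_poly P m.+1 K ->
  uniform_poly P m (leading_reduction n m G K).
Proof.
move=> nm UG UK; have [sG PG] := UG; have [sK PK] := UK.
have U : uniform_poly P m.+3 (leading_reduction n m G K).
  apply: uniform_polyW (uniform_polyB PR (uniform_polyM PR (uniform_polyC PR (PG n)) UK)
   (uniform_polyM PR (uniform_polyM PR (uniform_polyC PR (PK m)) (uniform_polyXn PR (m-n))) UG)).
  by rewrite geq_max; lia.
split=> [t|]; last by case: U.
apply/leq_sizeP => j mj; rewrite coefB coefCM -mulrA coefCM coefXnM.
case: ltnP => [jmn|mnj]; first by have := leq_ltn_trans mj jmn; rewrite ltnNge leq_subr.
move: mj; rewrite leq_eqVlt => /predU1P[<-|mj].
  by rewrite subKn// mulrC subrr.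
have -> : (K t)`_j = 0 by apply/(leq_sizeP _ _ (sK t)).
have -> : (G t)`_(j - (m - n)) = 0 by apply/(leq_sizeP _ _ (sG t)); lia.
by rewrite !mulr0 subrr.
Qed.

(** Only the remainder has to be uniform in [t], since only its coefficients enter a constructible
    condition; the exponent and the quotient may vary. *)
Lemma pseudo_remainder n G m K : uniform_poly P n.+1 G -> uniform_poly P m K ->
  exists R, uniform_poly P n R /\
    forall t, exists j u, ((G t)`_n ^+ j)%:P * K t = u * G t + R t.
Proof.
move=> UG; have [sG PG] := UG; elim: m K => [|m IH] K UK.
  exists K; split; first exact: uniform_polyW UK.
  by move=> t; exists 0%N, 0; rewrite mul0r add0r mul1r.
have [mn|nm] := ltnP m n.
  exists K; split; first exact: uniform_polyW UK.
  by move=> t; exists 0%N, 0; rewrite mul0r add0r mul1r.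
have UK1 := uniform_leading_reduction nm UG UK.
have [R [UR KR]] := IH _ UK1; exists R; split=> // t.
have [j [u E]] := KR t; exists j.+1, (u + ((G t)`_n ^+ j)%:P * (((K t)`_m)%:P * 'X^(m - n))).
rewrite mulrDl addrAC -E /leading_reduction mulrBr exprSr polyCM !mulrA subrK //.
Qed.

(** [p] splits into linear factors, each of which divides [q]; whatever the multiplicities, the
    product of all deg p of them divides the power of [q] with that exponent. *)
Lemma roots_dvdp_exp (p q : {poly C}) : p != 0 ->
  (forall x, p.[x] = 0 -> q.[x] = 0) -> p %| q ^+ (size p).-1.
Proof.
move=> p0 pq; have [r pr] := closed_field_poly_normal p.
have lp0 : lead_coef p != 0 by rewrite lead_coef_eq0.
have -> : (size p).-1 = size r.
  by rewrite {1}pr size_scale// size_prod_XsubC.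
have {}pq x : x \in r -> 'X - x%:P %| q.
  move=> xr; rewrite dvdp_XsubCl; apply/rootP/pq; rewrite pr hornerZ.
  by move: xr; rewrite -root_prod_XsubC => /rootP ->; rewrite mulr0.
rewrite pr dvdpZl//; elim: r {pr} pq => [|x r IH] pq.
  by rewrite big_nil expr0 dvd1p.
rewrite big_cons exprS dvdp_mul//; first exact/pq/mem_head.
by apply: IH => y yr; apply: pq; rewrite inE yr orbT.
Qed.

(** When [G] has exact degree [n], [H] vanishes at all its roots iff [G] divides [H ^+ n], that is,
    iff the pseudo-remainder of [H ^+ n] by [G] is zero. *)
Lemma constructible_one_equation n G m H :
  uniform_poly P n.+1 G -> uniform_poly P m H ->
  constructible P (fun t => (G t)`_n <> 0 /\
    exists x, (G t).[x] = 0 /\ (H t).[x] <> 0).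
Proof.
move=> UG UH; have [k UHn] := uniform_polyX_exp PR n UH.
have [R [UR KR]] := pseudo_remainder UG UHn; have [sG PG] := UG; have [sR PRR] := UR.
apply: constructible_ext (constructibleI (constructibleN (constructible_zero (PG n)))
  (constructible_poly_neq0 UR)) => t.
split=> -[Gn0 X]; split=> //; have [j [u E]] := KR t.
  have sGn : size (G t) = n.+1.
    apply/eqP; rewrite eqn_leq sG /= ltnNge; apply/negP => /leq_sizeP /(_ n (leqnn _)).
    exact: Gn0.
  apply: contrapT => /forallNP nx; apply: X.
  have Gt0 : G t != 0 by rewrite -size_poly_eq0 sGn.
  have : G t %| H t ^+ (size (G t)).-1.
    apply: roots_dvdp_exp => // x Gx; apply: contrapT => Hx; exact: (nx x).
  rewrite sGn /= => D.
  have : G t %| R t.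
    by rewrite -(@dvdp_addr _ (u * G t)) ?dvdp_mull// -E dvdp_mull.
  apply: contraPP => /eqP R0 /(dvdp_leq R0).
  by rewrite sGn; apply/negP; rewrite -leqNgt.
move=> R0; have [x [Gx Hx]] := X; apply: Hx.
have := congr1 (horner^~ x) E; rewrite R0 addr0 !hornerM Gx mulr0 hornerC horner_exp.
move/eqP; rewrite mulf_eq0 !expf_eq0 => /orP[/andP[_ /eqP//]|/andP[_ /eqP//]].
Qed.

Definition poly_system := seq (nat * (T -> {poly C})).

Definition uniform_system (L : poly_system) : Prop :=
  forall p, List.In p L -> uniform_poly P p.1 p.2.

Definition solves (L : poly_system) (t : T) (x : C) : Prop :=
  forall p, List.In p L -> (p.2 t).[x] = 0.

Lemma solves_cons p L t x : solves (p :: L) t x <-> (p.2 t).[x] = 0 /\ solves L t x.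
Proof.
split=> [s|[s1 s2] q /= [<-//|]]; last exact: s2.
by split; [apply: s; left|move=> q qL; apply: s; right].
Qed.

Lemma uniform_system_cons p L :
  uniform_poly P p.1 p.2 -> uniform_system L -> uniform_system (p :: L).
Proof. by move=> up uL q /= [<-//|/uL]. Qed.

Lemma infinite_closed_field (p : {poly C}) : (exists x, p.[x] <> 0) <-> p <> 0.
Proof.
split=> [[x px] p0|/eqP/closed_nonrootP[x /rootP px]]; last by exists x.
by apply: px; rewrite p0 horner0.
Qed.

Lemma constructible_if f S S0 S1 : P f -> constructible P S0 -> constructible P S1 ->
  (forall t, f t = 0 -> (S t <-> S0 t)) -> (forall t, f t <> 0 -> (S t <-> S1 t)) ->
  constructible P S.
Proof.
move=> Pf c0 c1 e0 e1; have cf := constructible_zero Pf.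
apply: constructible_ext (constructibleU (constructibleI cf c0)
  (constructibleI (constructibleN cf) c1)) => t.
have [f0|f0] := pselect (f t = 0).
  by rewrite (e0 _ f0); split=> [[[]|[]]//|]; left.
by rewrite (e1 _ f0); split=> [[[]|[]]//|]; right.
Qed.

Lemma solves_reduction n m (G K : T -> {poly C}) L t x : (G t)`_n <> 0 ->
  (G t).[x] = 0 /\ (K t).[x] = 0 /\ solves L t x <->
  (G t).[x] = 0 /\ (leading_reduction n m G K t).[x] = 0 /\ solves L t x.
Proof.
move=> /eqP c0; split=> -[Gx [Kx s]]; do 2!split => //.
  by rewrite /leading_reduction hornerD hornerN !hornerM Gx Kx !mulr0 subr0.
move: Kx; rewrite /leading_reduction hornerD hornerN !hornerM Gx mulr0 subr0 hornerC.
by move/eqP; rewrite mulf_eq0 (negbTE c0) => /eqP.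
Qed.

Lemma solves_trunc n (G : T -> {poly C}) t x : (G t)`_n = 0 ->
  (G t).[x] = 0 <-> (G t - ((G t)`_n)%:P * 'X^n).[x] = 0.
Proof. by move=> ->; rewrite mul0r subr0. Qed.

(** Induction on the total formal size. Of two equations, the one of smaller size reduces the other
    if its leading coefficient is nonzero, and is truncated otherwise; an equation of formal size 0
    reads 0 = 0. At most one equation remains in the end. *)
Lemma constructible_system k L m H :
  (\sum_(p <- L) p.1.+1 <= k)%N -> uniform_system L -> uniform_poly P m H ->
  constructible P (fun t => exists x, solves L t x /\ (H t).[x] <> 0).
Proof.
move=> + + UH; elim: k L => [|k IH] [|[[|n] G] L].
- move=> _ _; apply: constructible_ext (constructible_poly_neq0 UH) => t.
  rewrite -infinite_closed_field; split=> [[x Hx]|[x [_ Hx]]]; exists x => //.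
  by split=> // p [].
- by rewrite big_cons.
- by rewrite big_cons.
- move=> _ _; apply: constructible_ext (constructible_poly_neq0 UH) => t.
  rewrite -infinite_closed_field; split=> [[x Hx]|[x [_ Hx]]]; exists x => //.
  by split=> // p [].
- rewrite big_cons /= add1n ltnS => sL uL.
  apply: constructible_ext (IH L sL (fun p pL => uL p (or_intror pL))) => t.
  have [sG _] := uL _ (or_introl erefl).
  have G0 : G t = 0 by apply/eqP; rewrite -size_poly_leq0.
  split=> -[x [s Hx]]; exists x; move: s; rewrite solves_cons /= ?G0 ?horner0//.
  by case.
rewrite big_cons /= => sL uL.
have UG : uniform_poly P n.+1 G := uL _ (or_introl erefl).
have [_ PG] := UG.
have cG : constructible P (fun t => exists x,
    solves ((n, fun t => G t - ((G t)`_n)%:P * 'X^n) :: L) t x /\ (H t).[x] <> 0).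
  apply: IH; first by rewrite big_cons /=; lia.
  by apply: uniform_system_cons => [|p pL]; [exact: uniform_poly_trunc|apply: uL; right].
have eG t : (G t)`_n = 0 -> (exists x, solves ((n.+1, G) :: L) t x /\ (H t).[x] <> 0) <->
    (exists x, solves ((n, fun t => G t - ((G t)`_n)%:P * 'X^n) :: L) t x /\ (H t).[x] <> 0).
  by move=> c0; split=> -[x]; rewrite solves_cons /= => Gx; exists x;
    rewrite solves_cons /=; have := solves_trunc x c0; tauto.
case: L sL uL cG eG => [|[[|m2] K] L] sL uL cG eG.
- apply: constructible_if (PG n) cG (constructible_one_equation UG UH) eG _ => t c0.
  split=> [[x []]|[_ [x [Gx Hx]]]].
    by rewrite solves_cons => -[Gx _] Hx; split=> //; exists x.
  by exists x; split=> //; apply/solves_cons; split=> // p [].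
- rewrite big_cons /= in sL.
  have cG' : constructible P (fun t => exists x, solves ((n.+1, G) :: L) t x /\ (H t).[x] <> 0).
    apply: IH; first by rewrite big_cons /=; lia.
    by move=> p /= [<-//|pL]; apply: uL; right; right.
  apply: constructible_ext cG' => t.
  have [sK _] := uL _ (or_intror (or_introl erefl)).
  have K0 : K t = 0 by apply/eqP; rewrite -size_poly_leq0.
  by split=> -[x [s Hx]]; exists x; move: s; rewrite !solves_cons /= ?K0 ?horner0//; tauto.
rewrite big_cons /= in sL.
have UK : uniform_poly P m2.+1 K := uL _ (or_intror (or_introl erefl)).
have [_ PK] := UK.
have uL' : uniform_system L by move=> p pL; apply: uL; right; right.
have cK : constructible P (fun t => exists x,
    solves [:: (n.+1, G), (m2, fun t => K t - ((K t)`_m2)%:P * 'X^m2) & L] t x /\ (H t).[x] <> 0).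
  apply: IH; first by rewrite !big_cons /=; lia.
  by do 2!apply: uniform_system_cons => //; exact: uniform_poly_trunc.
have eK t : (K t)`_m2 = 0 ->
    (exists x, solves [:: (n.+1, G), (m2.+1, K) & L] t x /\ (H t).[x] <> 0) <->
    (exists x, solves [:: (n.+1, G), (m2, fun t => K t - ((K t)`_m2)%:P * 'X^m2) & L] t x /\
       (H t).[x] <> 0).
  by move=> c0; split=> -[x]; rewrite !solves_cons /= => Kx; exists x;
    rewrite !solves_cons /=; have := solves_trunc x c0; tauto.
have [nm|mn] := leqP n m2.
  have cR : constructible P (fun t => exists x,
      solves [:: (n.+1, G), (m2, leading_reduction n m2 G K) & L] t x /\ (H t).[x] <> 0).
    apply: IH; first by rewrite !big_cons /=; lia.
    by do 2!apply: uniform_system_cons => //; exact: uniform_leading_reduction.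
  apply: constructible_if (PG n) cG cR eG _ => t c0.
  by split=> -[x [s Hx]]; exists x; move: s; rewrite !solves_cons /=;
    have := @solves_reduction n m2 G K L t x c0; tauto.
have cR : constructible P (fun t => exists x,
    solves [:: (n, leading_reduction m2 n K G), (m2.+1, K) & L] t x /\ (H t).[x] <> 0).
  apply: IH; first by rewrite !big_cons /=; lia.
  have UR := uniform_leading_reduction (ltnW mn) UK UG.
  by apply: uniform_system_cons => //; apply: uniform_system_cons.
apply: constructible_if (PK m2) cK cR eK _ => t c0.
by split=> -[x [s Hx]]; exists x; move: s; rewrite !solves_cons /=;
  have := @solves_reduction m2 n K G L t x c0; tauto.
Qed.
End Basic.

Section Projection.
Variables (T : Type) (P : (T -> C) -> Prop) (PR : fun_ring P).

Definition basic_set (U : Type) (L : seq (U -> C)) (h : U -> C) (u : U) : Prop :=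
  (forall f, List.In f L -> f u = 0) /\ h u <> 0.

(** Disjunctive normal form, needed because an existential quantifier passes through unions but not
    through complements. *)
Definition disjunctive (U : Type) (Q : (U -> C) -> Prop) (S : U -> Prop) : Prop :=
  exists D : seq (seq (U -> C) * (U -> C)),
    (forall b, List.In b D -> (forall f, List.In f b.1 -> Q f) /\ Q b.2) /\
    forall u, S u <-> exists2 b, List.In b D & basic_set b.1 b.2 u.

Lemma disjunctiveU U Q (S S' : U -> Prop) : disjunctive Q S -> disjunctive Q S' ->
  disjunctive Q (fun u => S u \/ S' u).
Proof.
move=> [D [QD SD]] [D' [QD' SD']]; exists (D ++ D')%list; split.
  by move=> b bDD; have [/QD|/QD'] := List.in_app_or _ _ _ bDD; exact.
move=> u; rewrite SD SD'; split=> [[[b bD bu]|[b bD bu]]|[b bDD bu]]; last first.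
- by have [bD|bD] := List.in_app_or _ _ _ bDD; [left|right]; exists b.
- by exists b => //; apply: List.in_or_app; right.
- by exists b => //; apply: List.in_or_app; left.
Qed.

Lemma disjunctive0 U Q : disjunctive Q (fun _ : U => False).
Proof. by exists [::]; split=> // u; split=> [//|[]]. Qed.

Lemma disjunctiveI U Q (S S' : U -> Prop) : fun_ring Q -> disjunctive Q S -> disjunctive Q S' ->
  disjunctive Q (fun u => S u /\ S' u).
Proof.
move=> QR [D [QD SD]] [D' [QD' SD']].
suff H : disjunctive Q (fun u => (exists2 b, List.In b D & basic_set b.1 b.2 u) /\ S' u).
  by move: H; congr disjunctive; apply/funext => u; apply/propext; rewrite SD.
elim: D {S SD} QD => [|b D IH] QD.
  have := @disjunctive0 U Q; congr disjunctive.
  by apply/funext => u; apply/propext; split=> // -[[]].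
have {}IH := IH (fun c cD => QD c (or_intror cD)).
have [Qb1 Qb2] := QD b (or_introl erefl).
have Hb : disjunctive Q (fun u => basic_set b.1 b.2 u /\ S' u).
  (* The equations are concatenated and the two inequations merge into their product. *)
  exists (map (fun c => ((b.1 ++ c.1)%list, fun u => b.2 u * c.2 u)) D'); split.
    move=> c /List.in_map_iff[d [<- /QD'[Qd1 Qd2]]] /=; split.
      by move=> f fL; have [/Qb1|/Qd1] := List.in_app_or _ _ _ fL; exact.
    exact: (fun_ringM QR).
  move=> u; rewrite SD'; split=> [[[b1 b2] [d dD [d1 d2]]]|
    [c /List.in_map_iff[d [<- dD]] [/= e1 /eqP]]].
    exists ((b.1 ++ d.1)%list, fun u => b.2 u * d.2 u).
      by apply/List.in_map_iff; exists d.
    split=> /=; first by move=> f fL; have [/b1|/d1] := List.in_app_or _ _ _ fL; exact.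
    by apply/eqP; rewrite mulf_neq0//; apply/eqP.
  rewrite mulf_eq0 negb_or => /andP[/eqP e2 /eqP e3]; split.
    by split=> // f fb; apply: e1; apply: List.in_or_app; left.
  by exists d => //; split=> // f fb; apply: e1; apply: List.in_or_app; right.
have := disjunctiveU Hb IH; congr disjunctive; apply/funext => u; apply/propext; split.
  move=> [[bu S'u]|[[c cD cu] S'u]]; split=> //; first by exists b => //; left.
  by exists c => //; right.
by move=> [[c /= [<-|cD] cu] S'u]; [left|right; split=> //; exists c].
Qed.

Lemma disjunctive_zero U Q (f : U -> C) : fun_ring Q -> Q f -> disjunctive Q (fun u => f u = 0).
Proof.
move=> QR Qf; exists [:: ([:: f], fun=> 1)]; split.
  by move=> b /= [<-/=|//]; split; [move=> g [<-|]|exact: fun_ring1].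
move=> u; split=> [fu|[b /= [<-/=|//] [+ _]]]; last by apply; left.
exists ([:: f], fun=> 1); first by left.
by split=> /=; [move=> g [<-|]|apply/eqP/oner_neq0].
Qed.

Lemma disjunctive_nonzero U Q (f : U -> C) : Q f -> disjunctive Q (fun u => f u <> 0).
Proof.
move=> Qf; exists [:: ([::], f)]; split; first by move=> b /= [<-/=|//].
by move=> u; split=> [fu|[b /= [<-/=|//] []//]]; exists ([::], f); [left|split].
Qed.

Lemma disjunctiveN U Q (S : U -> Prop) : fun_ring Q -> disjunctive Q S ->
  disjunctive Q (fun u => ~ S u).
Proof.
move=> QR [D [QD SD]].
suff H : disjunctive Q (fun u => ~ exists2 b, List.In b D & basic_set b.1 b.2 u).
  by move: H; congr disjunctive; apply/funext => u; apply/propext; rewrite SD.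
elim: D {S SD} QD => [|b D IH] QD.
  have := disjunctive_zero QR (fun_ring0 QR); congr disjunctive.
  by apply/funext => u; apply/propext; split=> // _ [].
have {}IH := IH (fun c cD => QD c (or_intror cD)).
have [Qb1 Qb2] := QD b (or_introl erefl).
have Hb : disjunctive Q (fun u => ~ basic_set b.1 b.2 u).
  have HL : disjunctive Q (fun u => exists2 f, List.In f b.1 & f u <> 0).
    elim: b.1 Qb1 => [|f L IHL] QL.
      have := @disjunctive0 U Q; congr disjunctive.
      by apply/funext => u; apply/propext; split=> // -[].
    have := disjunctiveU (disjunctive_nonzero (QL f (or_introl erefl)))
      (IHL (fun g gL => QL g (or_intror gL))).
    congr disjunctive; apply/funext => u; apply/propext; split.
      by move=> [fu|[g gL gu]]; [exists f => //; left|exists g => //; right].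
    by move=> [g /= [<-|gL] gu]; [left|right; exists g].
  have := disjunctiveU HL (disjunctive_zero QR Qb2); congr disjunctive.
  apply/funext => u; apply/propext; split.
    by move=> [[f fb fu] [bu _]|bu [_ []//]]; apply: fu; apply: bu.
  move=> nb; apply: contrapT => /not_orP[nf nh]; apply: nb; split=> // f fb.
  by apply: contrapT => fu; apply: nf; exists f.
have := disjunctiveI QR Hb IH; congr disjunctive; apply/funext => u; apply/propext; split.
  by move=> [nb nD] [c /= [<-|cD] cu]; [apply: nb|apply: nD; exists c].
by move=> nD; split=> [bu|[c cD cu]]; apply: nD; [exists b => //; left|exists c => //; right].
Qed.

Lemma constructible_disjunctive U Q (S : U -> Prop) : fun_ring Q ->
  constructible Q S -> disjunctive Q S.
Proof.
move=> QR; elim=> {S} [f Qf|S _ IH|S S' _ IH _ IH'].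
- exact: disjunctive_zero.
- exact: disjunctiveN.
- exact: disjunctiveI.
Qed.

Theorem constructible_exists (S : T * C -> Prop) :
  constructible (poly_ring P) S -> constructible P (fun t => exists x, S (t, x)).
Proof.
move=> /(constructible_disjunctive (poly_ring_fun_ring PR))[D [QD SD]].
suff H : constructible P (fun t => exists x, exists2 b, List.In b D & basic_set b.1 b.2 (t, x)).
  by apply: constructible_ext H => t; split=> -[x Sx]; exists x; apply/SD.
elim: D {S SD} QD => [|b D IH] QD.
  by apply: constructible_ext (constructible_const PR False) => t; split=> // -[x []].
have {}IH := IH (fun c cD => QD c (or_intror cD)).
have [Qb1 [m [H [UH bH]]]] := QD b (or_introl erefl).
have [L [uL Lb]] : exists L, uniform_system P L /\
    forall t x, solves L t x <-> forall f, List.In f b.1 -> f (t, x) = 0.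
  elim: b.1 Qb1 => [|f L IHL] QL; first by exists [::]; split=> [p []|t x]; split=> // _ p [].
  have [L' [uL' L'L]] := IHL (fun g gL => QL g (or_intror gL)).
  have [n [G [UG fG]]] := QL f (or_introl erefl).
  exists ((n, G) :: L'); split; first exact: uniform_system_cons.
  move=> t x; rewrite solves_cons /= -fG L'L; split=> [[fx Lx] g [<-//|/Lx//]|Lx].
  by split=> [|g gL]; apply: Lx; [left|right].
have cb := constructible_system PR (leqnn _) uL UH.
apply: constructible_ext (constructibleU cb IH) => t; split.
  move=> [[x [s Hx]]|[x [c cD cx]]]; exists x; last by exists c => //; right.
  by exists b; [left|split; [apply/Lb|rewrite bH]].
move=> [x [c /= [<-|cD] cx]]; [left|right]; exists x; last by exists c.
by case: cx => /Lb s; rewrite bH.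
Qed.
End Projection.

End Constructible.

(** * Generic matrices *)

Section OrdinalsMod3.
Variables (V : nmodType) (j : 'I_3).

Lemma ord3_neq : (j + 1 == j = false) * (j + 2 == j = false) * (j + 2 == j + 1 = false)
  * (j == j + 1 = false) * (j == j + 2 = false) * (j + 1 == j + 2 = false).
Proof. by case: j => [[|[|[|]]]]. Qed.

Lemma ord3_add : (j + 1 + 1 = j + 2) * (j + 1 + 2 = j) * (j + 2 + 1 = j) * (j + 2 + 2 = j + 1).
Proof. by case: j => [[|[|[|]]]] //= i; repeat split; apply/val_inj. Qed.

Lemma ord3_case i : [\/ i = j, i = j + 1 | i = j + 2].
Proof.
have := @ord3_neq; case: j i => [[|[|[|]]]] //= ? [[|[|[|]]]] //= ? _;
  by [apply: Or31; apply/val_inj|apply: Or32; apply/val_inj|apply: Or33; apply/val_inj].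
Qed.

Lemma ord3_forall (P : 'I_3 -> Prop) : P j -> P (j + 1) -> P (j + 2) -> forall i, P i.
Proof. by move=> p0 p1 p2 i; have [->|->|->] := ord3_case i. Qed.

Lemma ord3_sum (F : 'I_3 -> V) : \sum_i F i = F j + F (j + 1) + F (j + 2).
Proof.
rewrite (bigD1 j)//= (bigD1 (j + 1)) ?ord3_neq//= (bigD1 (j + 2)) ?ord3_neq//=.
rewrite big1 ?addr0 ?addrA// => i.
by have [->|->|->] := ord3_case i; rewrite ?ord3_add ?eqxx ?andbF.
Qed.
End OrdinalsMod3.

Section Generic.
Variable C : numClosedFieldType.
Local Notation M3 := 'M[C]_3.

(** The integer polynomials in the nine entries, kept as functions: induction on this predicate
    replaces polynomial bookkeeping. *)
Inductive entry_fun : (M3 -> C) -> Prop :=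
| entry_fun_entry i j : entry_fun (fun A => A i j)
| entry_fun1 : entry_fun (fun=> 1)
| entry_funB f g : entry_fun f -> entry_fun g -> entry_fun (fun A => f A - g A)
| entry_funM f g : entry_fun f -> entry_fun g -> entry_fun (fun A => f A * g A).

Lemma entry_fun_ring : fun_ring entry_fun.
Proof. by split; [exact: entry_fun1|exact: entry_funB|exact: entry_funM]. Qed.

Lemma entry_fun_comp g (h : M3 -> M3) : entry_fun g ->
  (forall i j, entry_fun (fun A => h A i j)) -> entry_fun (fun A => g (h A)).
Proof.
move=> + hh; elim=> [i j|||]//; first exact: entry_fun1.
  by move=> f f' _ IH _ IH'; apply: entry_funB.
by move=> f f' _ IH _ IH'; apply: entry_funM.
Qed.

Lemma entry_fun_mpoly g : entry_fun g ->
  exists q : {mpoly rat[3 * 3]}, forall A, g A = mmap ratr (fun k => mxvec A 0 k) q.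
Proof.
elim=> [i j||f f' _ [p fp] _ [q fq]|f f' _ [p fp] _ [q fq]].
- by exists 'X_(mxvec_index i j) => A; rewrite mmapX mmap1U mxvecE.
- by exists 1 => A; rewrite rmorph1.
- by exists (p - q) => A; rewrite rmorphB /= fp fq.
- by exists (p * q) => A; rewrite rmorphM /= fp fq.
Qed.

Definition generic (A : M3) : Prop :=
  forall g, entry_fun g -> g A = 0 -> forall A0, g A0 = 0.

Lemma alg_indep_generic A : alg_indep_over_Q (fun k => mxvec A 0 k) -> generic A.
Proof.
move=> iA g /entry_fun_mpoly[q gq] gA A0.
by rewrite gq (iA q) -?gq// raddf0.
Qed.

(** An equation that holds at [A] holds identically, and one that fails at [A] fails on an open set
    [D <> 0]; so membership is constant on such a set around [A]. A property of [A] can thus be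
    verified at any other matrix with [D <> 0]. *)
Lemma generic_decides A S : generic A -> constructible entry_fun S ->
  exists D, [/\ entry_fun D, D A <> 0 & forall A', D A' <> 0 -> (S A' <-> S A)].
Proof.
move=> gA; elim=> {S} [f ff|S _ [D [fD DA DS]]|S S' _ [D [fD DA DS]] _ [D' [fD' DA' DS']]].
- have [fA|fA] := pselect (f A = 0).
    exists (fun=> 1); split; [exact: entry_fun1|exact/eqP/oner_neq0|move=> A' _].
    by rewrite fA (gA f).
  by exists f; split.
- by exists D; split=> // A' /DS ->.
- exists (fun A => D A * D' A); split; first exact: entry_funM.
    by apply/eqP; rewrite mulf_neq0//; apply/eqP.
  by move=> A' /eqP; rewrite mulf_eq0 negb_or => /andP[/eqP/DS -> /eqP/DS' ->].
Qed.

Lemma entry_fun_sign n : entry_fun (fun=> (-1) ^+ n).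
Proof. exact: (fun_ringX entry_fun_ring n (fun_ringN entry_fun_ring entry_fun1)). Qed.

Lemma entry_fun_adj i j : entry_fun (fun A => (\adj A) i j).
Proof.
have E : (fun A : M3 => (\adj A) i j) = (fun A => (-1) ^+ (j + i) *
    \sum_(s : {perm 'I_2}) (-1) ^+ s * \prod_k A (lift j k) (lift i (s k))).
  apply/funext => A; rewrite mxE /cofactor /determinant; congr (_ * _).
  by apply: eq_bigr => s _; congr (_ * _); apply: eq_bigr => k _; rewrite !mxE.
rewrite E; apply: entry_funM; first exact: entry_fun_sign.
apply: (fun_ring_sum entry_fun_ring) => s; apply: entry_funM.
  exact: entry_fun_sign.
by apply: (fun_ring_prod entry_fun_ring) => k; exact: entry_fun_entry.
Qed.

Lemma entry_fun_det : entry_fun (fun A => \det A).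
Proof.
apply: (fun_ring_sum entry_fun_ring) => s; apply: entry_funM.
  exact: entry_fun_sign.
by apply: (fun_ring_prod entry_fun_ring) => k; exact: entry_fun_entry.
Qed.

Lemma generic_unitmx A : generic A -> A \in unitmx.
Proof.
move=> gA; rewrite unitmxE unitfE; apply/eqP => /(gA _ entry_fun_det)/(_ 1%:M)/eqP.
by rewrite det1 oner_eq0.
Qed.

Lemma adj_invmx n (B : 'M[C]_n) : B \in unitmx -> \adj B = \det B *: invmx B.
Proof.
by move=> uB; rewrite /invmx uB scalerA divff ?scale1r// -unitfE -unitmxE.
Qed.

(* An invertible A0 is the adjugate of c A0^-1 when c ^+ 2 = \det A0. *)
Lemma generic_adj A : generic A -> generic (\adj A).
Proof.
move=> gA g fg gadj.
have g0 := gA _ (entry_fun_comp fg entry_fun_adj) gadj.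
(* The determinant factor settles the singular matrices, which the square root argument does not
   reach. *)
have fgd : entry_fun (fun A => g A * \det A) by apply: entry_funM => //; exact: entry_fun_det.
have H A0 : g A0 * \det A0 = 0.
  have [d0|d0] := eqVneq (\det A0) 0; first by rewrite d0 mulr0.
  have uA0 : A0 \in unitmx by rewrite unitmxE unitfE.
  pose c := sqrtC (\det A0); have c0 : c != 0 by rewrite sqrtC_eq0.
  have := g0 (c *: invmx A0); suff -> : \adj (c *: invmx A0) = A0 by move->; rewrite mul0r.
  have uc : c *: invmx A0 \in unitmx by rewrite unitmxZ ?unitfE// unitmx_inv.
  rewrite adj_invmx//.
  rewrite invmxZ// invmxK detZ det_inv scalerA.
  rewrite -[RHS]scale1r; congr (_ *: _).
  have <- : c ^+ 2 = \det A0 by rewrite sqrtCK.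
  by field.
have /eqP := H A; rewrite mulf_eq0 orbC.
have := generic_unitmx gA; rewrite unitmxE unitfE => /negbTE -> /= /eqP.
exact: gA.
Qed.
End Generic.

(** * Orbits of the exceptional points *)

Section LinearRecurrence.
Variable K : fieldType.

(** An initial segment of maximal rank already spans all rows. The vanishing minors keep that rank
    below [n], so a nonzero column of the cokernel kills every row. *)
Lemma dependent_rows n (r : nat -> 'rV[K]_n) :
  (forall f : 'I_n -> nat, \det (\matrix_i r (f i)) = 0) ->
  exists2 c : 'cV[K]_n, c != 0 & forall k, r k *m c = 0.
Proof.
move=> r0; pose E N := \matrix_(k < N) r k.
have [m [N mN] maxm] : exists2 m, exists N, \rank (E N) = m &
    forall N, (\rank (E N) <= m)%N.
  have H1 : exists m, `[< exists N, \rank (E N) = m >].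
    by exists (\rank (E 0%N)); apply/asboolP; exists 0%N.
  have H2 m : `[< exists N, \rank (E N) = m >] -> (m <= n)%N.
    by move=> /asboolP[N <-]; exact: rank_leq_col.
  case: (ex_maxnP H1 H2) => m /asboolP[N mN] mmax; exists m; first by exists N.
  by move=> N'; apply: mmax; apply/asboolP; exists N'.
have sE k M : (k < M)%N -> (r k <= E M)%MS.
  by move=> kM; rewrite -[r k](rowK (fun k : 'I_M => r k) (Ordinal kM)) row_sub.
have Esub k : (r k <= E N)%MS.
  pose M := maxn N k.+1.
  have EN : (E N <= E M)%MS.
    apply/row_subP => i; rewrite rowK; apply: sE.
    by rewrite (leq_trans (ltn_ord i))// leq_maxl.
  have /mxrank_leqif_eq[_] := EN.
  rewrite mN eqn_leq -{1}mN (mxrankS EN) maxm /= => /esym/eqmxP EE.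
  by rewrite EE sE// leq_maxr.
have rn : (\rank (E N) < n)%N.
  rewrite ltn_neqAle rank_leq_col andbT; apply/negP => fE.
  have := fullrowsub_unit fE; rewrite unitmxE.
  set X := (X in \det X); suff -> : X = \matrix_i r (fullrankfun fE i) by rewrite r0 unitr0.
  by apply/matrixP => i j; rewrite !mxE.
have : cokermx (E N) != 0 by rewrite -mxrank_eq0 mxrank_coker subn_eq0 -ltnNge.
have [j cj] : exists j, cokermx (E N) != 0 -> col j (cokermx (E N)) != 0.
  case: (pickP (fun j => col j (cokermx (E N)) != 0)) => [j cj|c0]; first by exists j.
  have n0 : (0 < n)%N by apply: leq_ltn_trans rn.
  exists (Ordinal n0) => /eqP[]; apply/matrixP => i k.
  by have /negbFE/eqP/matrixP/(_ i 0) := c0 k; rewrite !mxE.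
move=> /cj c0; exists (col j (cokermx (E N))) => // k.
have /submxP[D ->] := Esub k.
by rewrite colE mulmxA -[D *m _ *m _]mulmxA mulmx_coker mulmx0 mul0mx.
Qed.

(** By linearity the powers may be replaced by any polynomial [q], and a Lagrange product isolates
    one coefficient. The exponents start at 1, hence the extra factor [l i], which must be
    nonzero. *)
Lemma independent_exponentials (I : finType) (c l : I -> K) :
  injective l -> (forall i, l i != 0) ->
  (forall k, \sum_i c i * l i ^+ k.+1 = 0) -> forall i, c i = 0.
Proof.
move=> injl l0 H i.
have Hq (q : {poly K}) : \sum_i c i * l i * q.[l i] = 0.
  under eq_bigr => j _ do rewrite horner_coef mulr_sumr.
  rewrite exchange_big /= big1// => k _.
  transitivity (q`_k * \sum_i c i * l i ^+ k.+1); last by rewrite H mulr0.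
  by rewrite mulr_sumr; apply: eq_bigr => j _; rewrite exprS; ring.
have := Hq (\prod_(j | j != i) ('X - (l j)%:P)).
rewrite (bigD1 i)//= [X in _ + X]big1 => [|j ji]; last first.
  by rewrite horner_prod (bigD1 j)//= hornerXsubC subrr mul0r mulr0.
rewrite addr0 horner_prod => /eqP; rewrite mulf_eq0 mulf_eq0 (negbTE (l0 i)) orbF.
move=> /orP[/eqP//|/prodf_eq0[j ji]].
by rewrite hornerXsubC subr_eq0 => /eqP/injl ij; rewrite ij eqxx in ji.
Qed.
End LinearRecurrence.

Section Polynomials.
Variable C : numFieldType.

(* Kronecker substitution: for large B the exponent m0 + B m1 + B^2 m2 determines
   the monomial. *)
Lemma mpoly_nonroot (P : {mpoly C[3]}) : P != 0 -> exists v : 'cV[C]_3, eval3 P v != 0.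
Proof.
move=> P0; pose B := msize P.
pose e (m : 'X_{1..3}) := (\sum_(i < 3) m i * B ^ i)%N.
pose q : {poly C} := \sum_(m <- msupp P) P@_m *: 'X^(e m).
have mB m i : m \in msupp P -> (m i < B)%N.
  move=> /msize_mdeg_lt; apply: leq_ltn_trans; rewrite mdegE (bigD1 i)//=.
  exact: leq_addr.
have B0 : (0 < B)%N by rewrite lt0n msize_poly_eq0.
have e_inj m m' : m \in msupp P -> m' \in msupp P -> e m = e m' -> m = m'.
  move=> mP m'P; rewrite /e !big_ord_recl !big_ord0 /= => E.
  have {}E : (m ord0 + B * (m (lift ord0 ord0) + B * m (lift ord0 (lift ord0 ord0))) =
     m' ord0 + B * (m' (lift ord0 ord0) + B * m' (lift ord0 (lift ord0 ord0))))%N.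
    by move: E; rewrite /bump /= expn0 expn1 !expnS expn0; lia.
  have E0 : m ord0 = m' ord0.
    have := congr1 (modn^~ B) E.
    by rewrite !(mulnC B) ![(m _ + _)%N]addnC ![(m' ord0 + _)%N]addnC !modnMDl !modn_small// mB.
  have E1 : m (lift ord0 ord0) = m' (lift ord0 ord0).
    move: E; rewrite E0 => /addnI/eqP; rewrite eqn_pmul2l// => /eqP E.
    have := congr1 (modn^~ B) E; rewrite !(mulnC B).
    by rewrite ![(m _ + _)%N]addnC ![(m' (lift ord0 ord0) + _)%N]addnC !modnMDl !modn_small// mB.
  have E2 : m (lift ord0 (lift ord0 ord0)) = m' (lift ord0 (lift ord0 ord0)).
    move: E; rewrite E0 E1 => /addnI/eqP; rewrite eqn_pmul2l// => /eqP/addnI/eqP.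
    by rewrite eqn_pmul2l// => /eqP.
  apply/mnmP => i; case: i => [[|[|[|]]]] //= ?.
  - by move: E0; congr (_ = _); congr (fun_of_multinom _ _); apply/val_inj.
  - by move: E1; congr (_ = _); congr (fun_of_multinom _ _); apply/val_inj.
  - by move: E2; congr (_ = _); congr (fun_of_multinom _ _); apply/val_inj.
have q0 : q != 0.
  apply: contraNneq P0 => q0; apply/eqP/mpolyP => m; rewrite mcoeff0.
  have [mP|/memN_msupp_eq0//] := boolP (m \in msupp P).
  have := congr1 (fun p : {poly C} => p`_(e m)) q0; rewrite coef0 coef_sum.
  rewrite (bigD1_seq m) ?msupp_uniq//= coefZ coefXn eqxx mulr1 big_seq_cond big1 ?addr0//.
  move=> m' /andP[m'P m'm]; rewrite coefZ coefXn; case: eqP => [E|]; last by rewrite mulr0.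
  by rewrite (e_inj _ _ mP m'P E) eqxx in m'm.
have [t qt] : exists t, q.[t] != 0.
  pose s := [seq (i%:R : C) | i <- iota 0 (size q)].
  have us : uniq s by rewrite map_inj_uniq ?iota_uniq// => i j /eqP; rewrite eqr_nat => /eqP.
  apply: contrapT => /forallNP H.
  have rs : all (root q) s.
    by apply/allP => x _; apply/eqP; apply: contrapT => /eqP; apply: H.
  by have := max_poly_roots q0 rs us; rewrite size_map size_iota ltnn.
exists (\col_i t ^+ (B ^ i)%N); suff -> : eval3 P (\col_i t ^+ (B ^ i)%N) = q.[t] by [].
rewrite /eval3 mevalE /q horner_sum; apply: eq_bigr => m _.
rewrite hornerZ hornerXn; congr (_ * _); rewrite /e.
rewrite (big_morph (fun n => t ^+ n) (id1 := 1) (op1 := *%R))//; last exact: exprD.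
by apply: eq_bigr => i _; rewrite mxE -exprM mulnC.
Qed.

Lemma eval3_scale d (P : {mpoly C[3]}) c v : homogeneous d P ->
  eval3 P (c *: v) = c ^+ d * eval3 P v.
Proof.
move=> /dhomogP hP; rewrite /eval3 !mevalE mulr_sumr big_seq [RHS]big_seq.
apply: eq_bigr => m mP; under eq_bigr => i _ do rewrite mxE exprMn.
rewrite big_split /= mulrCA; congr (_ * _).
have -> : d = (\sum_i m i)%N by rewrite -mdegE (hP m mP).
by rewrite (big_morph (fun n => c ^+ n) (exprD c) (expr0 c)).
Qed.
End Polynomials.

(** * Density of the orbit of a column of a generic matrix *)

Section Dynamics.
Variable C : numClosedFieldType.
Local Notation V3 := 'cV[C]_3.
Local Notation M3 := 'M[C]_3.

Definition crem (v : V3) : V3 := \col_i (v (i + 1) 0 * v (i + 2) 0).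
Definition fwd (A : M3) (v : V3) : V3 := A *m crem v.
(** With [B] the adjugate of [A] this inverts [fwd A] up to a scalar; unlike the inverse matrix, the
    adjugate has polynomial entries. *)
Definition bwd (B : M3) (v : V3) : V3 := crem (B *m v).

Lemma crem_scale c v : crem (c *: v) = c ^+ 2 *: crem v.
Proof. by apply/colP => i; rewrite !mxE expr2; ring. Qed.

Lemma crem_crem v : crem (crem v) = (v 0 0 * v 1 0 * v 2 0) *: v.
Proof.
by apply/colP; apply: (@ord3_forall 0); rewrite !mxE ?ord3_add ?add0r; ring.
Qed.

Lemma fwd_scale A c v : fwd A (c *: v) = c ^+ 2 *: fwd A v.
Proof. by rewrite /fwd crem_scale -scalemxAr. Qed.

Lemma fwd_scalel A c v : fwd (c *: A) v = c *: fwd A v.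
Proof. by rewrite /fwd -scalemxAl. Qed.

Lemma fwd_coord A v j i : fwd A v i 0 = A i j * (v (j + 1) 0 * v (j + 2) 0) +
  A i (j + 1) * (v (j + 2) 0 * v j 0) + A i (j + 2) * (v j 0 * v (j + 1) 0).
Proof. by rewrite mxE (ord3_sum j) !mxE !ord3_add. Qed.

Lemma iter_fwd_scale A c k v :
  iter k (fwd A) (c *: v) = c ^+ (2 ^ k)%N *: iter k (fwd A) v.
Proof. by elim: k => [|k IH]; rewrite ?expr1// !iterS IH fwd_scale -exprM -expnSr. Qed.

Lemma fun_ring_iter_fwd (T : Type) (Q : (T -> C) -> Prop) (A : T -> M3) (v : T -> V3) k :
  fun_ring Q -> (forall i j, Q (fun t => A t i j)) -> (forall i, Q (fun t => v t i 0)) ->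
  forall i, Q (fun t => iter k (fwd (A t)) (v t) i 0).
Proof.
move=> QR QA Qv; elim: k => [//|k IH] i.
pose g t := \sum_j A t i j *
  (iter k (fwd (A t)) (v t) (j + 1) 0 * iter k (fwd (A t)) (v t) (j + 2) 0).
suff -> : (fun t => iter k.+1 (fwd (A t)) (v t) i 0) = g.
  by apply: (fun_ring_sum QR) => j; apply: (fun_ringM QR) => //; apply: (fun_ringM QR).
by apply/funext => t; rewrite iterS mxE; apply: eq_bigr => j _; rewrite !mxE.
Qed.

(* In the affine chart x_j = 1 the map [fwd (product_matrix j)] is the product
   (y, z) |-> (4 - 3/y, 3 - 2/z) of two Moebius maps; [product_point j] parametrizes
   it so that it becomes (U, V) |-> (2U, 3V). *)
Definition product_matrix (j : 'I_3) : M3 := \matrix_(i, k)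
  if i == j then (k == j)%:R
  else if i == j + 1 then 4%:R * (k == j)%:R - 3%:R * (k == j + 1)%:R
  else 3%:R * (k == j)%:R - 2%:R * (k == j + 2)%:R.

Definition product_point (j : 'I_3) (U V : C) : V3 := \col_i
  if i == j then (V - 1) * (U - 1)
  else if i == j + 1 then (3%:R * V - 1) * (U - 1)
  else (V - 1) * (2%:R * U - 1).

Lemma fwd_product_point j U V : fwd (product_matrix j) (product_point j U V) =
  ((U - 1) * (V - 1)) *: product_point j (2%:R * U) (3%:R * V).
Proof.
apply/colP; apply: (@ord3_forall j); rewrite (fwd_coord _ _ j) !mxE !ord3_neq !eqxx /=; ring.
Qed.

Lemma product_orbit j : exists c, forall k, c k != 0 /\
  product_point j (2%:R ^+ k.+1) (3%:R ^+ k.+1) =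
  c k *: iter k (fwd (product_matrix j)) (col j (product_matrix j)).
Proof.
have Hk : forall k, exists c, c != 0 /\ product_point j (2%:R ^+ k.+1) (3%:R ^+ k.+1) =
    c *: iter k (fwd (product_matrix j)) (col j (product_matrix j)).
  elim=> [|k [c [c0 E]]].
    (* At (U, V) = (2, 3) the point is twice the column, whose coordinates j, j + 1, j + 2 are 1, 4,
       3. *)
    exists 2%:R; split; first by rewrite pnatr_eq0.
    apply/colP; apply: (@ord3_forall j); rewrite !mxE !ord3_neq ?eqxx /=; ring.
  have ne (a : nat) : (1 < a)%N -> (a%:R : C) ^+ k.+1 - 1 != 0.
    move=> a1; rewrite subr_eq0 -natrX -[1]/(1%:R) eqr_nat -(exp1n k.+1) eqn_exp2r//.
    by rewrite gtn_eqF.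
  pose s : C := (2%:R ^+ k.+1 - 1) * (3%:R ^+ k.+1 - 1).
  have s0 : s != 0 by rewrite mulf_neq0// ne.
  exists (c ^+ 2 / s); split; first by rewrite mulf_neq0 ?invr_neq0 ?expf_neq0.
  have := congr1 (fwd (product_matrix j)) E.
  rewrite fwd_product_point fwd_scale -iterS -!exprS => E'.
  by rewrite mulrC -scalerA -E' scalerA mulVf// scale1r.
by exists (fun k => projT1 (cid (Hk k))) => k; exact: (projT2 (cid (Hk k))).
Qed.

(** Along the sequence [P] becomes a combination of powers of the numbers 2^a 3^b, which are
    distinct by unique factorization. So [P] vanishes at all product points, and up to scale these
    fill a Zariski open part of the plane. *)
Lemma product_point_poly_zero j d (P : {mpoly C[3]}) : homogeneous d P ->
  (forall k, eval3 P (product_point j (2%:R ^+ k.+1) (3%:R ^+ k.+1)) = 0) -> P = 0.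
Proof.
(* All functions on a one-point set, that is, the constants; adjoining two variables gives the
   polynomials in U and V. *)
move=> hP H; pose top (_ : unit -> C) := True.
have topR : fun_ring top by [].
pose R2 := poly_ring (poly_ring top).
have R1R := poly_ring_fun_ring topR; have R2R : fun_ring R2 := poly_ring_fun_ring R1R.
pose g (t : unit * C * C) := eval3 P (product_point j t.1.2 t.2).
have R2c (c : C) : R2 (fun=> c) by do 2!apply: poly_ring_base => //.
have R2U : R2 (fun t => t.1.2) by apply: (poly_ring_base R1R); exact: poly_ring_var.
have R2V : R2 (fun t => t.2) by exact: poly_ring_var.
have R2p i : R2 (fun t => product_point j t.1.2 t.2 i 0).
  have R2B := fun_ringB R2R; have R2M := fun_ringM R2R.
  pose h0 (t : unit * C * C) := (t.2 - 1) * (t.1.2 - 1).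
  pose h1 (t : unit * C * C) := (3%:R * t.2 - 1) * (t.1.2 - 1).
  pose h2 (t : unit * C * C) := (t.2 - 1) * (2%:R * t.1.2 - 1).
  have Rh0 : R2 h0 by apply: (R2M); apply: (R2B).
  have Rh1 : R2 h1 by apply: (R2M); apply: (R2B) => //; apply: (R2M).
  have Rh2 : R2 h2 by apply: (R2M); apply: (R2B) => //; apply: (R2M).
  have [->|->|->] := ord3_case j i; [move: Rh0|move: Rh1|move: Rh2];
    by congr R2; apply/funext => t; rewrite !mxE ?ord3_neq ?eqxx.
have R2g : R2 g.
  have -> : g = (fun t => \sum_(m <- msupp P) P@_m *
      \prod_i (product_point j t.1.2 t.2) i 0 ^+ m i).
    by apply/funext => t; rewrite /g /eval3 mevalE.
  apply: (fun_ring_sum R2R) => m; apply: (fun_ringM R2R) => //.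
  by apply: (fun_ring_prod R2R) => i; exact: (fun_ringX R2R).
have [n [G [[sG PG] gG]]] := R2g.
have [m [c gc]] : exists m c, forall U V,
    g (tt, U, V) = \sum_(a < m) \sum_(b < n) c a b * U ^+ a * V ^+ b.
  have /choice[F HF] i := PG i.
  have /choice[E HE] i := HF i.
  pose m := \max_(i < n) F i.
  exists m, (fun a b => (E b tt)`_a) => U V.
  rewrite gG (horner_coef_wide _ (sG _)) exchange_big /=.
  apply: eq_bigr => b _; have [[sE _] ->] := HE b.
  have sEm : (size (E b tt) <= m)%N by apply: leq_trans (sE tt) _; exact: (leq_bigmax b).
  by rewrite (horner_coef_wide _ sEm) mulr_suml.
have c0 (ab : 'I_m * 'I_n) : c ab.1 ab.2 = 0.
  apply: (@independent_exponentials _ _ (fun ab : 'I_m * 'I_n => c ab.1 ab.2)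
    (fun ab => ((2 ^ ab.1 * 3 ^ ab.2)%N)%:R)).
  - move=> [a b] [a' b'] /= /eqP; rewrite eqr_nat => /eqP E.
    have Ea := congr1 (logn 2) E; have Eb := congr1 (logn 3) E.
    move: Ea Eb; rewrite !lognM ?expn_gt0// !lognX /=.
    rewrite ![logn _ _]/= !muln0 !muln1 !addn0 !add0n => Ea Eb.
    by congr (_, _); apply/val_inj.
  - by move=> [a b] /=; rewrite pnatr_eq0 -lt0n muln_gt0 !expn_gt0.
  - move=> k; have := H k; rewrite -[eval3 _ _]/(g (tt, _, _)) gc pair_big /= => E; rewrite -[RHS]E.
    apply: eq_bigr => -[a b] _ /=; rewrite natrM !natrX exprMn -!exprM -mulrA.
    by rewrite ![(_ * k.+1)%N]mulnC.
have g0 U V : eval3 P (product_point j U V) = 0.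
  rewrite -[eval3 _ _]/(g (tt, U, V)) gc big1// => a _; rewrite big1// => b _.
  by rewrite (c0 (a, b)) !mul0r.
apply/eqP; apply: contraT => P0.
(* The extra factors are the denominators met when [v] is solved for U, V and the scale, so a point
   where [Q] is nonzero is a multiple of a product point. *)
pose Q := P * 'X_j * ('X_(j + 1) - 3%:R *: 'X_j) * ('X_(j + 2) - 2%:R *: 'X_j).
have X0 (i k : 'I_3) (a : C) : i != k -> 'X_i - a *: 'X_k != 0 :> {mpoly C[3]}.
  move=> ik; apply/eqP => /(congr1 (mcoeff U_(i))); rewrite mcoeffB mcoeffZ !mcoeffX mcoeff0.
  rewrite eqxx; case: eqP => [/(congr1 (fun m : 'X_{1..3} => m i))|_ /eqP].
    by rewrite !mnm1E eqxx eq_sym (negbTE ik).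
  by rewrite mulr0 subr0 oner_eq0.
have Q0 : Q != 0.
  rewrite !mulf_neq0 ?X0 ?ord3_neq//.
  apply/eqP => /(congr1 (mcoeff U_(j))); rewrite mcoeffX eqxx mcoeff0 => /eqP.
  by rewrite oner_eq0.
have [v] := mpoly_nonroot Q0; rewrite /eval3 /Q !mevalM !mevalB !mevalZ !mevalXU.
rewrite !mulf_eq0 !negb_or -!andbA => /and4P[Pv vj v1 v2].
pose U := (v (j + 2) 0 - v j 0) / (v (j + 2) 0 - 2%:R * v j 0).
pose V := (v (j + 1) 0 - v j 0) / (v (j + 1) 0 - 3%:R * v j 0).
pose s := (v (j + 1) 0 - 3%:R * v j 0) * (v (j + 2) 0 - 2%:R * v j 0) / (2%:R * v j 0).
have /(congr1 (fun x => s ^+ d * x)) := g0 U V; rewrite -(eval3_scale _ _ hP) mulr0.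
suff -> : s *: product_point j U V = v by move=> E; rewrite -/(eval3 P v) E eqxx in Pv.
apply/colP; apply: (@ord3_forall j); rewrite !mxE !ord3_neq ?eqxx /s /U /V;
  field; rewrite ?vj ?v1 ?v2 ?pnatr_eq0//.
Qed.

(** A relation along the orbit kills all maximal minors of the table of values of the monomials of
    [P]. By genericity the minors also vanish at [product_matrix j], where they produce a nonzero
    form with the same monomials that vanishes on a dense orbit. *)
Theorem generic_orbit_dense A j d (P : {mpoly C[3]}) : generic A -> homogeneous d P ->
  (forall k, eval3 P (iter k (fwd A) (col j A)) = 0) -> P = 0.
Proof.
move=> gA hP H; apply/eqP; apply: contraT => P0.
pose s := msupp P; pose n := size s; pose mon (i : 'I_n) : 'X_{1..3} := nth 0%MM s i.
pose orb B k := iter k (fwd B) (col j B).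
pose row B k : 'rV[C]_n := \row_i eval3 'X_[mon i] (orb B k).
have rowf B k c : (row B k *m c) 0 0 = eval3 (\sum_i c i 0 *: 'X_[mon i]) (orb B k).
  by rewrite mxE /eval3 raddf_sum /=; apply: eq_bigr => i _; rewrite mevalZ mulrC !mxE.
have PE : P = \sum_(i < n) P@_(mon i) *: 'X_[mon i].
  by rewrite {1}[P]mpolyE (big_nth 0%MM) big_mkord.
have det0 (f : 'I_n -> nat) B : \det (\matrix_i row B (f i)) = 0.
  have fdet : entry_fun (fun B => \det (\matrix_i row B (f i))).
    have ER := entry_fun_ring C.
    apply: (fun_ring_sum ER) => p; apply: entry_funM; first exact: entry_fun_sign.
    apply: (fun_ring_prod ER) => i.
    pose h B := \prod_k (orb B (f i)) k 0 ^+ mon (p i) k.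
    suff -> : (fun B => (\matrix_i row B (f i)) i (p i)) = h.
      apply: (fun_ring_prod ER) => k; apply: (fun_ringX ER).
      apply: (fun_ring_iter_fwd _ ER) => [|l]; first exact: entry_fun_entry.
      move: (entry_fun_entry C l j).
      by congr entry_fun; apply/funext => M; rewrite mxE.
    by apply/funext => M; rewrite !mxE /eval3 mevalX.
  apply: (gA _ fdet); apply/eqP.
  pose c : 'cV[C]_n := \col_i P@_(mon i).
  rewrite -det_tr; apply/det0P; exists c^T.
    apply/eqP => /rowP c0; have n0 : (0 < n)%N by rewrite lt0n size_eq0 msupp_eq0.
    have := c0 (Ordinal n0); rewrite !mxE => /eqP; rewrite mcoeff_eq0.
    by rewrite mem_nth.
  rewrite -trmx_mul; apply/eqP; rewrite trmx_eq0; apply/eqP/colP => i.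
  have <- : (row A (f i) *m c) 0 0 = (0 : 'cV_n) i 0.
    by rewrite rowf mxE -[RHS](H (f i)); congr eval3; rewrite [RHS]PE;
      apply: eq_bigr => l _; rewrite mxE.
  by rewrite !mxE; apply: eq_bigr => l _; rewrite !mxE.
have [c c0 Hc] := dependent_rows (fun f => det0 f (product_matrix j)).
pose Q := \sum_i c i 0 *: 'X_[mon i].
have hQ : homogeneous d Q.
  apply: rpred_sum => i _; apply: rpredZ; rewrite dhomogX; apply/eqP.
  have /dhomogP hP' := hP; apply: hP'; exact: mem_nth.
have Q0 : Q = 0.
  have [e He] := product_orbit j.
  apply: (product_point_poly_zero hQ) => k.
  rewrite (_ : product_point _ _ _ = e k *: orb (product_matrix j) k); last exact: (He k).2.
  by rewrite (eval3_scale _ _ hQ) -[eval3 _ _]rowf Hc mxE mulr0.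
case/eqP: c0; apply/colP => i; rewrite mxE.
have := congr1 (mcoeff (mon i)) Q0; rewrite mcoeff0 raddf_sum /= (bigD1 i)//=.
rewrite mcoeffZ mcoeffX eqxx mulr1 big1 ?addr0// => l li.
rewrite mcoeffZ mcoeffX; case: eqP => [/eqP|]; last by rewrite mulr0.
by rewrite nth_uniq ?msupp_uniq// => /eqP/val_inj E; rewrite E eqxx in li.
Qed.
End Dynamics.

(** * Cycles of a perturbed system *)

Section Contraction.
Variables (R : realType) (I : Type) (rho : R).
Hypothesis rho0 : 0 <= rho.
Implicit Types x : I -> R.

Definition in_box x := forall i, `|x i| <= rho.

Lemma half_pow_small (e c : R) : 0 < e -> exists k, c * 2^-1 ^+ k < e.
Proof.
move=> e0; have [k ck] : exists k : nat, c / e < k%:R.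
  by exists (Num.truncn `|c / e|).+1; rewrite (le_lt_trans (ler_norm _))// truncnS_gt.
exists k; rewrite exprVn ltr_pdivrMr ?exprn_gt0// mulrC -ltr_pdivrMr//.
rewrite (lt_trans ck)// -natrX ltr_nat; exact: ltn_expl.
Qed.

(** Bounds are taken in the sup norm over an arbitrary index type. The limit is built
    coordinatewise, as the supremum of the lower ends of nested intervals around the iterates. *)
Lemma half_contraction_fixpoint (T : (I -> R) -> I -> R) :
  (forall x, in_box x -> in_box (T x)) ->
  (forall x x' d, 0 <= d -> in_box x -> in_box x' -> (forall i, `|x i - x' i| <= d) ->
     forall i, `|T x i - T x' i| <= d / 2) ->
  exists2 x, in_box x & forall i, T x i = x i.
Proof.
move=> Tbox Tcon; pose u k := iter k T (fun=> 0).
have ubox k : in_box (u k).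
  by elim: k => [i|k IH]; [rewrite normr0|exact: Tbox].
have p0 k : 0 <= rho * 2^-1 ^+ k by rewrite mulr_ge0// exprn_ge0// invr_ge0.
have ustep k i : `|u k.+1 i - u k i| <= rho * 2^-1 ^+ k.
  elim: k i => [|k IH] i.
    by rewrite expr0 mulr1 subr0; exact: (ubox 1%N).
  by have := Tcon _ _ _ (p0 k) (ubox k.+1) (ubox k) IH i; rewrite exprSr mulrA.
(* The sum of the step bounds from [k] on, a geometric series of ratio 1/2. *)
pose w k := 2 * rho * 2^-1 ^+ k.
have wS k : w k.+1 = w k - rho * 2^-1 ^+ k by rewrite /w exprSr; field.
have w0 k : 0 <= w k by rewrite /w !mulr_ge0// exprn_ge0// invr_ge0.
have lmono i k j : (k <= j)%N -> u k i - w k <= u j i - w j /\ u j i + w j <= u k i + w k.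
  elim: j => [|j IH]; first by rewrite leqn0 => /eqP ->.
  rewrite leq_eqVlt => /predU1P[->//|/IH[IH1 IH2]].
  have := ustep j i; rewrite wS ler_norml => /andP[]; split; lra.
have lu i k j : u k i - w k <= u j i + w j.
  have [/(lmono i)[]|/ltnW/(lmono i)[]] := leqP k j; have := w0 j; have := w0 k; lra.
pose S i := [set u k i - w k | k in [set: nat]]%classic.
pose x i := sup (S i).
have xl i k : u k i - w k <= x i.
  apply: ub_le_sup; last by exists k.
  by exists (u 0%N i + w 0%N) => _ [j _ <-].
have xu i k : x i <= u k i + w k.
  by apply: ge_sup; [exists (u 0%N i - w 0%N), 0%N|move=> _ [j _ <-]].
have ux i k : `|x i - u k i| <= w k.
  by rewrite ler_norml; have := xl i k; have := xu i k; lra.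
have xbox : in_box x.
  move=> i; apply: contrapT => /negP; rewrite -ltNge => h.
  have [k] := @half_pow_small (`|x i| - rho) (2 * rho) ltac:(by rewrite subr_gt0).
  rewrite -/(w k); have := ux i k; have := ubox k i.
  have := ler_normD (x i - u k i) (u k i); rewrite subrK; lra.
exists x => // i; apply/eqP; rewrite -subr_eq0 -normr_le0 leNgt; apply/negP => h.
have [k] := @half_pow_small `|T x i - x i| (2 * rho) h; rewrite -/(w k).
have := Tcon _ _ (w k) (w0 k) xbox (ubox k) (fun i => ux i k) i.
have := ux i k.+1; rewrite distrC /= => h1 h2.
have := ler_normD (T x i - T (u k) i) (T (u k) i - x i); rewrite addrA subrK.
have := wS k; have : w k = 2 * (rho * 2^-1 ^+ k) by rewrite /w mulrA.
move: h1; rewrite -/(u k.+1) /= ; lra.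
Qed.

(** Both bounds are carried together because the Lipschitz constant of a product involves the sizes
    of its factors; estimating [T] then becomes arithmetic on constants. *)
Definition bounded_lipschitz (M L : R) (g : (I -> R) -> R) : Prop :=
  (forall x, in_box x -> `|g x| <= M) /\
  (forall x x' d, 0 <= d -> in_box x -> in_box x' -> (forall i, `|x i - x' i| <= d) ->
     `|g x - g x'| <= L * d).

Lemma bounded_lipschitz_cst c : bounded_lipschitz `|c| 0 (fun=> c).
Proof. by split=> // *; rewrite subrr normr0 mul0r. Qed.

Lemma bounded_lipschitz_coord i : bounded_lipschitz rho 1 (fun x => x i).
Proof. by split=> [x|x x' d _ _ _] /(_ i)//; rewrite mul1r. Qed.

Lemma bounded_lipschitzD M L M' L' g h :
  bounded_lipschitz M L g -> bounded_lipschitz M' L' h ->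
  bounded_lipschitz (M + M') (L + L') (fun x => g x + h x).
Proof.
move=> [gM gL] [hM hL]; split=> [x bx|x x' d d0 bx bx' xx'].
  by rewrite (le_trans (ler_normD _ _))// lerD ?gM ?hM.
have -> : g x + h x - (g x' + h x') = (g x - g x') + (h x - h x') by ring.
by rewrite mulrDl (le_trans (ler_normD _ _))// lerD ?gL ?hL.
Qed.

Lemma bounded_lipschitzM M L M' L' g h :
  bounded_lipschitz M L g -> bounded_lipschitz M' L' h ->
  bounded_lipschitz (M * M') (M * L' + M' * L) (fun x => g x * h x).
Proof.
move=> [gM gL] [hM hL]; split=> [x bx|x x' d d0 bx bx' xx'].
  by rewrite normrM ler_pM ?gM ?hM.
have -> : g x * h x - g x' * h x' = g x * (h x - h x') + h x' * (g x - g x') by ring.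
rewrite mulrDl -!mulrA (le_trans (ler_normD _ _))// !normrM.
by rewrite lerD// ler_pM// ?gM ?hM ?gL ?hL.
Qed.

Lemma bounded_lipschitzW M L M' L' g : bounded_lipschitz M L g ->
  M <= M' -> L <= L' -> bounded_lipschitz M' L' g.
Proof.
move=> [gM gL] MM LL; split=> [x bx|x x' d d0 bx bx' xx']; first exact: le_trans (gM _ bx) MM.
by rewrite (le_trans (gL _ _ _ d0 bx bx' xx'))// ler_wpM2r.
Qed.
End Contraction.

Section RealCycle.
Variables (R : realType) (N : nat) (n0 : 'I_N) (Th : 'M[R]_3).

(* For the base matrix and eps = 0 the cycle equations read
   (y - 1)(y - 2) = 0 and z = y + 1 at every time, so that every sequence of ones and twos
   is a nondegenerate solution. *)
Definition base_entry (i j : nat) : int :=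
  nth 0 (nth [::] [:: [:: 0; 1; -1]; [:: 1; 2; - (6)]; [:: 0; 1; -1]] i) j.

Hypothesis Th_near : forall i j : 'I_3, `|Th i j - (base_entry i j)%:~R| <= 100000%:R^-1.

(* x (false, n) and 32^-1 x (true, n) are the deviations of y_n from s n and of z_n - y_n
   from 1; the sign sg n is the inverse of the derivative of (y - 1)(y - 2) at s n.  Fixed
   points of T are the cycles for eps = 1/1000, and T is 1/2-Lipschitz on a small box. *)
Let e (i j : 'I_3) : R := Th i j - (base_entry i j)%:~R.
Let I := (bool * 'I_N)%type.
Let s (n : 'I_N) : R := if n == n0 then 2 else 1.
Let sg (n : 'I_N) : R := if n == n0 then 1 else -1.
Let y n (x : I -> R) := s n + x (false, n).
Let m n (x : I -> R) := 1 + 32%:R^-1 * x (true, n).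
Let z n (x : I -> R) := y n x + m n x.
Let E i n (x : I -> R) :=
  e i 0 * (y n x * z n x) + (e i 1 * z n x + e i 2%:R * y n x).
Let T (x : I -> R) (k : I) : R :=
  if k.1 then
    let p := ord_pred k.2 in
    32%:R * (E 2%:R p x + - 1 * (E 0 p x * m k.2 x))
      + (- 32%:R^-1) * (x (true, p) * x (true, k.2))
  else - sg k.2 * ((x k * x k + 32%:R^-1 * (x (true, k.2) * (s k.2 + 2 + x k)))
    + (E 1 k.2 x + - 1000%:R^-1 * ((m k.2 x + E 0 k.2 x) * y (ordS k.2) x))).

Local Notation bl := (bounded_lipschitz 16%:R^-1).

Let bl_x k : bl 16%:R^-1 1 (fun x : I -> R => x k).
Proof. exact: bounded_lipschitz_coord. Qed.
Let bl_c (c M : R) : `|c| <= M -> bl M 0 (fun _ : I -> R => c).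
Proof.
by move=> cM; exact: (bounded_lipschitzW (bounded_lipschitz_cst I _ c) cM (lexx 0)).
Qed.
Let s_le n : `|s n| <= 2.
Proof. by rewrite /s; case: ifP => _; rewrite ger0_norm; lra. Qed.
Let sg_le n : `|- sg n| <= 1.
Proof. by rewrite normrN /sg; case: ifP => _; rewrite ?normrN normr1. Qed.
Let e_le i j : `|e i j| <= 100000%:R^-1.
Proof. exact: Th_near. Qed.
Let c_le (c : R) : 0 <= c -> `|c| <= c. Proof. by move=> /ger0_norm ->. Qed.
Let cN_le (c : R) : 0 <= c -> `|- c| <= c. Proof. by move=> /ger0_norm; rewrite normrN => ->. Qed.

Let bl_y n : bl 3 1 (y n).
Proof.
refine (bounded_lipschitzW (bounded_lipschitzD (bl_c (s_le n)) (bl_x (false, n))) _ _); lra.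
Qed.
Let bl_m n : bl 2 (32%:R^-1) (m n).
Proof.
have c32 : `|32%:R^-1 : R| <= 32%:R^-1 by apply: c_le; lra.
have c1 : `|1 : R| <= 1 by rewrite normr1.
refine (bounded_lipschitzW (bounded_lipschitzD (bl_c c1)
  (bounded_lipschitzM (bl_c c32) (bl_x (true, n)))) _ _); lra.
Qed.
Let bl_z n : bl 5 2 (z n).
Proof. refine (bounded_lipschitzW (bounded_lipschitzD (bl_y n) (bl_m n)) _ _); lra. Qed.
Let bl_E i n : bl (23%:R / 100000%:R) (14%:R / 100000%:R) (E i n).
Proof.
refine (bounded_lipschitzW (bounded_lipschitzD
  (bounded_lipschitzM (bl_c (e_le i 0)) (bounded_lipschitzM (bl_y n) (bl_z n)))
  (bounded_lipschitzD (bounded_lipschitzM (bl_c (e_le i 1)) (bl_z n))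
     (bounded_lipschitzM (bl_c (e_le i 2%:R)) (bl_y n)))) _ _); lra.
Qed.

(** The weight 32 damps the effect of z - y on the equation for y, where its coefficient is about 4,
    to about 1/8; the square contributes another 1/8. In return the errors of [Th] are multiplied by
    32, which the radius 1/100000 absorbs. *)
Let bl_T k : bl 16%:R^-1 2^-1 (fun x => T x k).
Proof.
have c32 : `|32%:R^-1 : R| <= 32%:R^-1 by apply: c_le; lra.
have c32N : `|- 32%:R^-1 : R| <= 32%:R^-1 by apply: cN_le; lra.
have c32' : `|32%:R : R| <= 32%:R by apply: c_le; lra.
have c1N : `|- 1 : R| <= 1 by rewrite normrN normr1.
have c2 : `|2 : R| <= 2 by apply: c_le; lra.
have c1000 : `|- 1000%:R^-1 : R| <= 1000%:R^-1 by apply: cN_le; lra.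
case: k => [[|] n] /=; rewrite /T /=.
  refine (bounded_lipschitzW (bounded_lipschitzD
    (bounded_lipschitzM (bl_c c32') (bounded_lipschitzD (bl_E 2%:R (ord_pred n))
       (bounded_lipschitzM (bl_c c1N) (bounded_lipschitzM (bl_E 0 (ord_pred n)) (bl_m n)))))
    (bounded_lipschitzM (bl_c c32N) (bounded_lipschitzM (bl_x (true, ord_pred n)) (bl_x (true, n))))) _ _);
    lra.
refine (bounded_lipschitzW (bounded_lipschitzM (bl_c (sg_le n))
  (bounded_lipschitzD
     (bounded_lipschitzD (bounded_lipschitzM (bl_x (false, n)) (bl_x (false, n)))
        (bounded_lipschitzM (bl_c c32) (bounded_lipschitzM (bl_x (true, n))
           (bounded_lipschitzD (bounded_lipschitzD (bl_c (s_le n)) (bl_c c2)) (bl_x (false, n))))))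
     (bounded_lipschitzD (bl_E 1 n) (bounded_lipschitzM (bl_c c1000)
        (bounded_lipschitzM (bounded_lipschitzD (bl_m n) (bl_E 0 n)) (bl_y (ordS n))))))) _ _);
  lra.
Qed.

(** The [G i] are the coordinates of [Th] applied to (YZ, Z, Y), the Cremona image of (1, Y, Z). The
    strict maximum of [Y] at [n0] excludes periods smaller than N. *)
Lemma real_cycle : exists Y Z : 'I_N -> R, forall n,
  let G i := Th i 0 * (Y n * Z n) + Th i 1 * Z n + Th i 2%:R * Y n in
  [/\ 0 < Y n, 0 < Z n, G 0 != 0,
      G 1 = 1000%:R^-1 * G 0 * Y (ordS n) & G 2%:R = G 0 * (Z (ordS n) - Y (ordS n))]
  /\ (n != n0 -> Y n < Y n0).
Proof.
have [||x x' d d0 bx bx' xx' k|x bx Tx] := @half_contraction_fixpoint R I 16%:R^-1 _ T; first by lra.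
- by move=> x bx k; apply: (proj1 (bl_T k)).
- by rewrite mulrC; apply: (proj2 (bl_T k)).
exists (fun n => y n x), (fun n => z n x) => n.
have xb k : - 16%:R^-1 <= x k <= 16%:R^-1 by rewrite -ler_norml; exact: bx.
have Em i : Th i 0 * (y n x * z n x) + Th i 1 * z n x + Th i 2%:R * y n x =
  (base_entry i 0%N)%:~R * (y n x * z n x) + (base_entry i 1%N)%:~R * z n x +
  (base_entry i 2%N)%:~R * y n x + E i n x.
  by rewrite /E /e; ring.
have E0 : - (23%:R / 100000%:R) <= E 0 n x <= 23%:R / 100000%:R.
  by rewrite -ler_norml; exact: (proj1 (bl_E 0 n)).
(* The fixed point equation for z - y involves the preceding time, so it is read at [ordS n]. *)
have ta := Tx (false, n); have tb := Tx (true, ordS n).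
have xa := xb (false, n); have xm := xb (true, n); have xa0 := xb (false, n0).
rewrite /T /= ordSK in tb; rewrite /T /= in ta.
have s1 : 1 <= s n <= 2 by rewrite /s; case: ifP => _; lra.
rewrite /= !Em /base_entry /=; split.
  rewrite /z /y /m; split.
  - lra.
  - lra.
  - apply/eqP => h; lra.
  - move: ta; rewrite /y /m; set Y' := s (ordS n) + x (false, ordS n).
    by rewrite /sg /s; case: (n == n0) => ta; lra.
  - by rewrite /m in tb; lra.
by move=> nn0; rewrite /y /s eqxx (negbTE nn0); lra.
Qed.
End RealCycle.

(** * Periodic points of every period *)

Section ExactPeriod.
Variable C : numClosedFieldType.
Local Notation V3 := 'cV[C]_3.
Local Notation M3 := 'M[C]_3.

Definition in_torus (v : V3) : Prop := forall i, v i 0 != 0.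

Definition exact_period (A : M3) (N : nat) (v : V3) : Prop :=
  [/\ forall k, in_torus (iter k (fwd A) v),
      exists l, iter N (fwd A) v = l *: v
    & forall k l, (0 < k < N)%N -> iter k (fwd A) v <> l *: v].

Definition affine_point (y z : C) : V3 := \col_i if i == 0 then 1 else if i == 1 then y else z.

(** Finitely many polynomial conditions, as elimination requires. Later lines are told apart from
    the first by the ratio of the coordinates 1 and 0 alone, the one that [real_cycle] controls. *)
Definition affine_cycle N (t : M3 * C * C) : Prop :=
  let v := affine_point t.1.2 t.2 in let F k := iter k (fwd t.1.1) v in
  \prod_(k < N.+1) \prod_i F k i 0 <> 0 /\
  (F N 1 0 - t.1.2 * F N 0 0 = 0 /\ F N 2 0 - t.2 * F N 0 0 = 0) /\
  \prod_(k < N.-1) (F k.+1 1 0 - t.1.2 * F k.+1 0 0) <> 0.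

Lemma constructible_affine_cycle N :
  constructible (@entry_fun C) (fun A => exists y z, affine_cycle N (A, y, z)).
Proof.
have R0 := entry_fun_ring C.
have R1 := poly_ring_fun_ring R0; have R2 := poly_ring_fun_ring R1.
apply: (constructible_exists R0 (S := fun t => exists z, affine_cycle N (t.1, t.2, z))).
apply: (constructible_ext (S := fun t => exists z, affine_cycle N (t, z))); first by case.
apply: (constructible_exists R1).
set Q := poly_ring _ in R2 *.
have Qy : Q (fun t => t.1.2) by apply: (poly_ring_base R1); exact: poly_ring_var.
have Qz : Q (fun t => t.2) by exact: poly_ring_var.
have QA i j : Q (fun t => t.1.1 i j).
  apply: (poly_ring_base R1 (f := fun t => t.1 i j)).
  exact: (poly_ring_base R0 (entry_fun_entry C i j)).
have Qv i : Q (fun t => affine_point t.1.2 t.2 i 0).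
  have [->|->|->] := ord3_case 0 i; [move: (fun_ring1 R2)|move: Qy|move: Qz];
    by congr Q; apply/funext => t; rewrite mxE.
have QF k i : Q (fun t => iter k (fwd t.1.1) (affine_point t.1.2 t.2) i 0).
  exact: (fun_ring_iter_fwd _ R2).
pose F k i (t : M3 * C * C) := iter k (fwd t.1.1) (affine_point t.1.2 t.2) i 0.
have c1 : constructible Q (fun t => \prod_(k < N.+1) \prod_i F k i t <> 0).
  apply/constructibleN/constructible_zero/(fun_ring_prod R2) => k.
  by apply: (fun_ring_prod R2) => i; exact: QF.
have c2 : constructible Q (fun t => F N 1 t - t.1.2 * F N 0 t = 0).
  apply/constructible_zero/(fun_ringB R2); first exact: QF.
  by apply: (fun_ringM R2) => //; exact: QF.
have c3 : constructible Q (fun t => F N 2 t - t.2 * F N 0 t = 0).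
  apply/constructible_zero/(fun_ringB R2); first exact: QF.
  by apply: (fun_ringM R2) => //; exact: QF.
have c4 : constructible Q (fun t => \prod_(k < N.-1) (F k.+1 1 t - t.1.2 * F k.+1 0 t) <> 0).
  apply/constructibleN/constructible_zero/(fun_ring_prod R2) => k.
  apply: (fun_ringB R2); first exact: QF.
  by apply: (fun_ringM R2) => //; exact: QF.
exact: (constructibleI c1 (constructibleI (constructibleI c2 c3) c4)).
Qed.

Lemma affine_cycle_exact_period A N y z : (0 < N)%N -> affine_cycle N (A, y, z) ->
  exact_period A N (affine_point y z).
Proof.
set v := affine_point y z; move=> N0 [/eqP/prodf_neq0 H1 [[H2 H3] /eqP/prodf_neq0 H4]].
have tor k : (k <= N)%N -> in_torus (iter k (fwd A) v).
  move=> kN i; have /prodf_neq0 := H1 (Ordinal (kN : k < N.+1)%N) isT.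
  exact.
have v0 : v 0 0 = 1 by rewrite mxE.
pose l := iter N (fwd A) v 0 0.
have FN : iter N (fwd A) v = l *: v.
  apply/colP; apply: (@ord3_forall 0); rewrite ?add0r [RHS]mxE [X in _ * X]mxE /=.
  - by rewrite mulr1.
  - by move/eqP: H2; rewrite subr_eq0 mulrC => /eqP.
  - by move/eqP: H3; rewrite subr_eq0 mulrC => /eqP.
split; last 2 first.
- by exists l.
- move=> k c /andP[k0 kN] E.
  have k1N : (k.-1 < N.-1)%N by lia.
  have Ek : (Ordinal k1N).+1 = k :> nat by rewrite /= prednK.
  have := H4 (Ordinal k1N) isT; rewrite Ek /= -/v E !mxE /=.
  by rewrite mulr1 mulrC subrr eqxx.
elim/ltn_ind => k IH; have [kN|Nk] := leqP k N; first exact: tor.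
rewrite -(subnK (ltnW Nk)) iterD FN iter_fwd_scale => i.
rewrite mxE mulf_neq0//; last by apply: IH; lia.
by rewrite expf_neq0//; exact: (tor N).
Qed.

(** Along a line of matrices a polynomial that is nonzero at one complex parameter is nonzero at
    some small real one; this is how complex matrices are traded for real ones. *)
Lemma entry_fun_line D (M E : M3) : entry_fun D -> exists q : {poly C}, forall t,
  D (M + t *: E) = q.[t].
Proof.
elim=> [i j||f g _ [p fp] _ [q gq]|f g _ [p fp] _ [q gq]].
- by exists ((M i j)%:P + (E i j)%:P * 'X) => t; rewrite !mxE !hornerE mulrC.
- by exists 1 => t; rewrite hornerE.
- by exists (p - q) => t; rewrite !hornerE fp gq.
- by exists (p * q) => t; rewrite !hornerE fp gq.
Qed.
End ExactPeriod.

(** * From a real box of matrices to generic complex matrices *)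

Section RealPerturbation.
Variable R : realType.
Local Notation C := (R[i] : numClosedFieldType).
Local Notation M3 := 'M[C]_3.
Local Notation emb := (real_complex R).

Lemma small_real_nonroot (q : {poly C}) (d : R) : q != 0 -> 0 < d ->
  exists2 t : R, `|t| <= d & q.[emb t] != 0.
Proof.
move=> q0 d0; pose s := [seq emb (d / i.+1%:R) | i <- iota 0 (size q)].
have us : uniq s.
  rewrite map_inj_uniq ?iota_uniq// => i j /fmorph_inj /(mulfI (lt0r_neq0 d0))/invr_inj/eqP.
  by rewrite eqr_nat => /eqP[].
have [x xs qx] : exists2 x, x \in s & q.[x] != 0.
  apply: contrapT => H; have rs : all (root q) s.
    by apply/allP => x xs; apply/eqP; apply: contrapT => /eqP qx; apply: H; exists x.
  by have := max_poly_roots q0 rs us; rewrite size_map size_iota ltnn.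
move/mapP: xs => [i _ xE]; exists (d / i.+1%:R); last by rewrite -xE.
have d0' := ltW d0; rewrite ger0_norm ?divr_ge0// ler_pdivrMr ?ltr0n//.
by rewrite ler_peMr// ler1n.
Qed.

(* The scaling under which [real_cycle] describes cycles of [fwd]. *)
Definition rescale (M : M3) : M3 := \matrix_(i, j)
  if i == 0 then 1000%:R^-1 * M 0 j
  else if i == 1 then M 1 j else M 1 j + 1000%:R^-1 * M 2 j.

Lemma rescale_line M E t : rescale (M + t *: E) = rescale M + t *: rescale E.
Proof. by apply/matrixP => i j; rewrite !mxE; case: ifP => _; [|case: ifP => _]; ring. Qed.

Lemma rescale_surj A : exists M, rescale M = A.
Proof.
exists (\matrix_(i, j) if i == 0 then 1000%:R * A 0 j
  else if i == 1 then A 1 j else 1000%:R * (A 2 j - A 1 j)).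
have n0 : 1000%:R != 0 :> C by rewrite pnatr_eq0.
apply/matrixP => i j; have [->|->|->] := ord3_case 0 i; rewrite ?add0r !mxE /=.
- by rewrite mulrA mulVf ?mul1r.
- by [].
- by rewrite mulrA mulVf// mul1r addrC subrK.
Qed.

Lemma affine_cycle_rescale N (Th : 'M[R]_3) : (0 < N)%N ->
  (forall i j : 'I_3, `|Th i j - (base_entry i j)%:~R| <= 100000%:R^-1) ->
  exists y z, affine_cycle N (rescale (map_mx emb Th), y, z).
Proof.
move=> N0 near; pose n0 := Ordinal N0.
have [Y [Z H]] := @real_cycle R N n0 Th near.
pose v n : 'cV[C]_3 := affine_point (emb (Y n)) (emb (Z n)).
pose G n i := Th i 0 * (Y n * Z n) + Th i 1 * Z n + Th i 2%:R * Y n.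
pose A : M3 := rescale (map_mx emb Th).
have e1000 : emb 1000%:R^-1 = 1000%:R^-1 by rewrite fmorphV rmorph_nat.
have step n : fwd A (v n) = emb (1000%:R^-1 * G n 0) *: v (ordS n).
  have [[_ _ _ G1 G2] _] := H n.
  apply/colP; apply: (@ord3_forall 0); rewrite ?add0r (fwd_coord _ _ 0) ?add0r !mxE /= -?e1000.
  - by rewrite mulr1 mul1r mulr1 -!rmorphM -!rmorphD; congr emb; rewrite /G; ring.
  - rewrite mulr1 mul1r -!rmorphM -!rmorphD; congr emb; rewrite -G1; ring.
  - rewrite mulr1 mul1r -!rmorphM -!rmorphD -!rmorphM -!rmorphD; congr emb.
    move: G1 G2; rewrite -/(G n 0) -/(G n 1) -/(G n 2%:R) => G1 G2.
    transitivity (G n 1 + 1000%:R^-1 * G n 2%:R); first by rewrite /G; ring.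
    by rewrite G1 G2; ring.
have orb k : exists2 c, c != 0 & iter k (fwd A) (v n0) = c *: v (iter k (@ordS N) n0).
  elim: k => [|k [c c0 E]]; first by exists 1; rewrite ?oner_eq0// scale1r.
  rewrite iterS E fwd_scale step scalerA; eexists; last by rewrite iterS.
  have [[_ _ g0 _ _] _] := H (iter k (@ordS N) n0).
  by rewrite mulf_neq0 ?expf_neq0// fmorph_eq0 mulf_neq0// invr_eq0 pnatr_eq0.
have vS k : iter k (@ordS N) n0 = (k %% N)%N :> nat.
  elim: k => [|k IH]; first by rewrite mod0n.
  by rewrite iterS /= IH -addn1 modnDml addn1.
have emb0 x : (emb x == 0) = (x == 0) by rewrite fmorph_eq0.
exists (emb (Y n0)), (emb (Z n0)); rewrite /affine_cycle /= -/(v n0) -/A.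
split; last split.
- apply/eqP/prodf_neq0 => k _; apply/prodf_neq0 => i _; have [c c0 ->] := orb k.
  have [[Y0 Z0 _ _ _] _] := H (iter k (@ordS N) n0).
  have [->|->|->] := ord3_case 0 i; rewrite ?add0r !mxE /= mulf_neq0// ?oner_eq0//.
    by rewrite emb0 gt_eqF.
  by rewrite emb0 gt_eqF.
- have [c c0 ->] := orb N; have -> : iter N (@ordS N) n0 = n0.
    by apply/val_inj; rewrite /= vS modnn.
  by rewrite !mxE /= mulr1 mulrC subrr mulrC subrr.
apply/eqP/prodf_neq0 => k _; rewrite -!iterS; have [c c0 ->] := orb k.+1.
have := H (iter k.+1 (@ordS N) n0); set n := iter _ _ _ => -[_].
have -> : n != n0.
  have kN : (k.+1 < N)%N by have := ltn_ord k; lia.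
  have := vS k.+1; rewrite -/n modn_small// => E.
  by apply/eqP => nn; move: E; rewrite nn.
move=> /(_ isT) lt; rewrite !mxE /= mulr1 mulrC -mulrBl -rmorphB mulf_neq0//.
by rewrite emb0 subr_eq0 lt_eqF.
Qed.

Lemma affine_cycle_near : exists2 dl : R, 0 < dl & forall N (Th : 'M[R]_3), (0 < N)%N ->
  (forall i j : 'I_3, `|Th i j - (base_entry i j)%:~R| <= dl) ->
  exists y z, affine_cycle N (rescale (map_mx emb Th), y, z).
Proof.
exists 100000%:R^-1; first by lra.
by move=> N Th; exact: affine_cycle_rescale.
Qed.

(** Before rescaling, the matrix is B + 1 X + i Y with [X] and [Y] real. The coefficients 1 and i
    are moved, one after the other, to small real numbers [s] and [t] without leaving [D <> 0]; the
    result is a real matrix near the base, where cycles exist. *)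
Theorem generic_exact_period (A : M3) N : (0 < N)%N -> generic A ->
  exists v, exact_period A N v.
Proof.
move=> N0 gA.
have [D [fD DA HD]] := generic_decides gA (constructible_affine_cycle C N).
have [dl dl0 Hdl] := affine_cycle_near.
suff [Th near DTh] : exists2 Th : 'M[R]_3,
    forall i j : 'I_3, `|Th i j - (base_entry i j)%:~R| <= dl &
    D (rescale (map_mx emb Th)) <> 0.
  have [y [z H]] := (HD _ DTh).1 (Hdl N Th N0 near).
  by exists (affine_point y z); exact: affine_cycle_exact_period.
have [M MA] := rescale_surj A.
pose B : 'M[R]_3 := \matrix_(i, j) (base_entry i j)%:~R.
pose X : 'M[R]_3 := \matrix_(i, j) (complex.Re (M i j)) - B.
pose Y : 'M[R]_3 := \matrix_(i, j) complex.Im (M i j).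
have ME : M = map_mx emb B + 1 *: map_mx emb X + 'i *: map_mx emb Y.
  apply/matrixP => i j; rewrite !mxE mul1r -rmorphD subrKC.
  by rewrite {1}[M i j]complexE.
pose K := \sum_i \sum_j (`|X i j| + `|Y i j|).
have XK i j : `|X i j| + `|Y i j| <= K.
  have nn a b : 0 <= `|X a b| + `|Y a b| by rewrite addr_ge0.
  rewrite /K (bigD1 i)//= (bigD1 j)//= -addrA lerDl addr_ge0// sumr_ge0// => *.
  by rewrite sumr_ge0.
have K0 : 0 <= K by apply: le_trans (XK 0 0); rewrite addr_ge0.
(* With [s] and [t] bounded by [d] the real matrix stays within [dl] of the base; the summand 1
   keeps the denominator positive. *)
pose d : R := dl / (K + 1).
have K1 : 0 < K + 1 by rewrite ltr_wpDl.
have d0 : 0 < d by rewrite divr_gt0.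
have [q Hq] := entry_fun_line (rescale (map_mx emb B + 'i *: map_mx emb Y)) (rescale (map_mx emb X)) fD.
have q0 : q != 0.
  apply/eqP => q0; apply: DA; have := Hq 1; rewrite q0 horner0 -rescale_line.
  by rewrite addrAC -ME MA.
have [s sd qs] := small_real_nonroot q0 d0.
have [p Hp] := entry_fun_line (rescale (map_mx emb B + emb s *: map_mx emb X)) (rescale (map_mx emb Y)) fD.
have p0 : p != 0.
  apply: contraNneq qs => p0.
  have E1 := Hq (emb s); have E2 := Hp 'i; rewrite -rescale_line in E1.
  rewrite -rescale_line in E2.
  by rewrite -E1 addrAC E2 p0 horner0.
have [t td pt] := small_real_nonroot p0 d0.
exists (B + s *: X + t *: Y).
  move=> i j.
  have -> : (B + s *: X + t *: Y) i j - (base_entry i j)%:~R = s * X i j + t * Y i j.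
    by rewrite !mxE; ring.
  rewrite (le_trans (ler_normD _ _))// !normrM.
  apply: (@le_trans _ _ (d * (`|X i j| + `|Y i j|))).
    by rewrite mulrDr lerD// ler_wpM2r.
  have dl0' := ltW dl0; rewrite /d -mulrA ler_piMr// mulrC ler_pdivrMr// mul1r.
  by rewrite (le_trans (XK i j))// lerDl ler01.
have -> : map_mx emb (B + s *: X + t *: Y) =
  map_mx emb B + emb s *: map_mx emb X + emb t *: map_mx emb Y.
  by apply/matrixP => i j; rewrite !mxE !(rmorphD, rmorphM, rmorphB).
by rewrite rescale_line Hp; exact/eqP.
Qed.
End RealPerturbation.

(** * Forms vanishing on an infinite set *)

Lemma ord3_distinct (i1 i2 i : 'I_3) : i1 != 0 -> i2 != 0 -> i1 != i2 ->
  [\/ i = 0, i = i1 | i = i2].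
Proof.
case: i1 => [[|[|[|]]]] //= ?; case: i2 => [[|[|[|]]]] //= ?;
  case: i => [[|[|[|]]]] //= ? *; solve [constructor 1; exact: val_inj |
  constructor 2; exact: val_inj | constructor 3; exact: val_inj].
Qed.

Section VanishingForms.
Variable C : numClosedFieldType.
Local Notation V3 := 'cV[C]_3.
Variable X : V3 -> Prop.

Definition vanishing_form (d : nat) (P : {mpoly C[3]}) : Prop :=
  homogeneous d P /\ forall v, X v -> eval3 P v = 0.

Definition in_closure (q : V3) : Prop :=
  forall d P, vanishing_form d P -> eval3 P q = 0.

Lemma in_closure_scale c q : c != 0 -> in_closure (c *: q) -> in_closure q.
Proof.
move=> c0 H d P VP; have := H d P VP; rewrite (eval3_scale _ _ VP.1) => /eqP.
by rewrite mulf_eq0 expf_eq0 (negbTE c0) andbF /= => /eqP.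
Qed.

Lemma vanishing_formM d P e Q : vanishing_form d P -> homogeneous e Q ->
  vanishing_form (d + e) (P * Q).
Proof.
move=> [hP XP] hQ; split=> [|v Xv]; first exact: dhomogM.
by rewrite /eval3 mevalM [P.@[_]]XP// mul0r.
Qed.

Lemma homogeneousX i : homogeneous 1 ('X_i : {mpoly C[3]}).
Proof. by rewrite /homogeneous dhomogX /= mdeg1. Qed.

Lemma homogeneousXn i n : homogeneous n ('X_i ^+ n : {mpoly C[3]}).
Proof. by have := dhomogMn n (homogeneousX i); rewrite mul1n. Qed.

Section Restriction.
Variables i1 i2 : 'I_3.
Hypotheses (i10 : i1 != 0) (i20 : i2 != 0) (i12 : i1 != i2).

Let ord3_cover i : [\/ i = 0, i = i1 | i = i2].
Proof. exact: ord3_distinct. Qed.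

Lemma ord3_cover_sum (V : nmodType) (F : 'I_3 -> V) : \sum_i F i = F 0 + F i1 + F i2.
Proof.
rewrite (bigD1 0)//= (bigD1 i1)//= (bigD1 i2)//=; last by rewrite i20 eq_sym.
rewrite big1 ?addr0 ?addrA// => i.
by have [->|->|->] := ord3_cover i; rewrite eqxx ?andbF.
Qed.

Lemma ord3_cover_prod (F : 'I_3 -> C) : \prod_i F i = F 0 * F i1 * F i2.
Proof.
rewrite (bigD1 0)//= (bigD1 i1)//= (bigD1 i2)//=; last by rewrite i20 eq_sym.
rewrite big1 ?mulr1 ?mulrA// => i.
by have [->|->|->] := ord3_cover i; rewrite eqxx ?andbF.
Qed.

(** The chart x_{i1} = 1 of the line x_0 = 0, with x_{i2} as its variable. *)
Definition line_coord (i : 'I_3) : {poly C} :=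
  if i == 0 then 0 else if i == i1 then 1 else 'X.

Definition restrict_line (P : {mpoly C[3]}) : {poly C} := mmap polyC line_coord P.

Lemma restrict_line_eval P x :
  (restrict_line P).[x] = eval3 P (\col_i (line_coord i).[x]).
Proof.
rewrite /restrict_line /mmap horner_sum /eval3 mevalE; apply: eq_bigr => m _.
rewrite hornerM hornerC /mmap1 horner_prod; congr (_ * _).
by apply: eq_bigr => i _; rewrite horner_exp mxE.
Qed.

Lemma restrict_lineM P Q : restrict_line (P * Q) = restrict_line P * restrict_line Q.
Proof. exact: rmorphM. Qed.

Lemma restrict_lineX i : restrict_line 'X_i = line_coord i.
Proof. by rewrite /restrict_line mmapX mmap1U. Qed.

Definition restricted (p : {poly C}) : Prop :=
  exists d P, vanishing_form d P /\ restrict_line P = p.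

Lemma line_coord1 : line_coord i1 = 1.
Proof. by rewrite /line_coord (negbTE i10) eqxx. Qed.

(** Degrees are equalized by powers of x_{i1}, which restrict to 1; so the restrictions of forms of
    all degrees together make an ideal. *)
Lemma restrictedD p q : restricted p -> restricted q -> restricted (p + q).
Proof.
wlog suff H : p q / forall d e P Q, (d <= e)%N -> vanishing_form d P -> vanishing_form e Q ->
    restrict_line P = p -> restrict_line Q = q -> restricted (p + q).
  move=> [d [P [VP rP]]] [e [Q [VQ rQ]]]; have [de|/ltnW ed] := leqP d e.
    exact: (H p q d e P Q).
  by rewrite addrC; exact: (H q p e d Q P).
move=> d e P Q de VP VQ <- <-.
exists e, (P * 'X_i1 ^+ (e - d) + Q); split.
  have [hP XP] : vanishing_form e (P * 'X_i1 ^+ (e - d)).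
    by rewrite -{1}(subnKC de); apply: vanishing_formM => //; exact: homogeneousXn.
  have [hQ XQ] := VQ; split; first exact: dhomogD.
  by move=> v Xv; rewrite /eval3 mevalD [X in X + _]XP// [X in _ + X]XQ// addr0.
rewrite {1}/restrict_line rmorphD rmorphM rmorphXn /= -/(restrict_line P).
by rewrite -/(restrict_line 'X_i1) restrict_lineX line_coord1 expr1n mulr1.
Qed.

Lemma restrictedZ c p : restricted p -> restricted (c%:P * p).
Proof.
move=> [d [P [[hP XP] <-]]]; exists d, (c *: P); split; last first.
  by rewrite /restrict_line mmapZ.
by split=> [|v Xv]; [exact: dhomogZ|rewrite /eval3 mevalZ [P.@[_]]XP// mulr0].
Qed.

Lemma restrictedX p : restricted p -> restricted (p * 'X).
Proof.
move=> [d [P [VP <-]]]; exists (d + 1)%N, (P * 'X_i2); split.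
  exact: vanishing_formM VP (homogeneousX i2).
by rewrite restrict_lineM restrict_lineX /line_coord (negbTE i20) eq_sym (negbTE i12).
Qed.

Lemma restrictedM p q : restricted p -> restricted (q * p).
Proof.
move=> rp; elim/poly_ind: q => [|q c IH].
  by have := restrictedZ 0 rp; rewrite polyC0.
rewrite mulrDl; apply: restrictedD; last exact: restrictedZ.
by rewrite mulrAC; exact: restrictedX.
Qed.

Hypothesis no_zero : forall q : V3, q != 0 -> q 0 0 = 0 -> ~ in_closure q.

Lemma restricted_nonroot x : exists2 p, restricted p & p.[x] != 0.
Proof.
pose q : V3 := \col_i (line_coord i).[x].
have q0 : q != 0.
  apply/eqP => /colP/(_ i1)/eqP; rewrite !mxE line_coord1 hornerC.
  by rewrite oner_eq0.
have q00 : q 0 0 = 0 by rewrite mxE /line_coord eqxx horner0.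
apply: contrapT => H; apply: (no_zero q0 q00) => d P VP.
apply: contrapT => /eqP Pq; apply: H; exists (restrict_line P); first by exists d, P.
by rewrite restrict_line_eval.
Qed.

(** A root of a nonzero restriction of least size would be a root of every restriction, by Euclidean
    division, and hence a point of the closure on the line. So the least size is 1. *)
Lemma restricted1 : restricted 1.
Proof.
have [n [g [rg g0 sg] gmin]] : exists2 n, (exists g, [/\ restricted g, g != 0 & size g = n]) &
    forall h, restricted h -> h != 0 -> (n <= size h)%N.
  have H : exists n, `[< exists g, [/\ restricted g, g != 0 & size g = n] >].
    have [p rp px] := restricted_nonroot 0; exists (size p); apply/asboolP; exists p; split=> //.
    by apply: contraNneq px => ->; rewrite horner0.
  case: (ex_minnP H) => n /asboolP Hn nmin; exists n => // h rh h0.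
  by apply: nmin; apply/asboolP; exists h.
have sg1 : size g = 1%N.
  apply/eqP; apply: contraT => /closed_rootP[x gx].
  have [p rp px] := restricted_nonroot x.
  have rr : restricted (p %% g).
    have -> : p %% g = p + (- (p %/ g)) * g by rewrite {2}(divp_eq p g) mulNr addrC addKr.
    by apply: restrictedD => //; exact: restrictedM.
  have [r0|r0] := eqVneq (p %% g) 0.
    move: px; rewrite (divp_eq p g) r0 addr0 hornerM (rootP gx) mulr0 eqxx.
    by [].
  by have := gmin _ rr r0; rewrite -sg leqNgt ltn_modp g0.
have [c c0 gE] := size_poly1P g (introT eqP sg1).
have := restrictedZ c^-1 rg; rewrite gE -polyCM mulVf//.
Qed.

(* The coefficients of a form P restricting to 1 are known on the monomials without x_0. *)
Lemma integral_equation : exists a (s : seq ('X_{1..3})) (c : 'X_{1..3} -> C), [/\ (0 < a)%N,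
  forall m, m \in s -> (m i1 + m i2 < a)%N
  & forall v : V3, v 0 0 = 1 -> in_closure v ->
    v i1 0 ^+ a = \sum_(m <- s) c m * (v i1 0 ^+ m i1 * v i2 0 ^+ m i2)].
Proof.
have [d [P0 [VP0 rP0]]] := restricted1.
(* The factor x_{i1} restricts to 1 and makes the degree [a] positive. *)
pose a := (d + 1)%N; pose P := P0 * 'X_i1.
have VP : vanishing_form a P := vanishing_formM VP0 (homogeneousX i1).
have rP : restrict_line P = 1 by rewrite restrict_lineM rP0 restrict_lineX line_coord1 mulr1.
have [/dhomogP hP _] := VP.
have mE m : m \in msupp P -> (m 0%R + m i1 + m i2)%N = a.
  by move=> /hP; rewrite /= mdegE ord3_cover_sum.
exists a, [seq m : 'X_{1..3} <- msupp P | m 0%R != 0%N], (fun m => - P@_m); split.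
- by rewrite /a addn1.
- by move=> m; rewrite mem_filter => /andP[m0 /mE]; lia.
move=> v v0 Zv; pose y := v i1 0; pose z := v i2 0.
(* Homogenization in degree [a], evaluated at (y, z): it recovers the terms of [P] without x_0 from
   the restriction. *)
pose H (p : {poly C}) := \sum_(k < a.+1) p`_k * (y ^+ (a - k) * z ^+ k).
have H1 : H 1 = y ^+ a.
  rewrite /H big_ord_recl subn0 expr0 coef1 mul1r mulr1 big1 ?addr0// => k _.
  by rewrite coef1 mul0r.
have HP : H (restrict_line P) = \sum_(m <- msupp P | m 0%R == 0%N) P@_m * (y ^+ m i1 * z ^+ m i2).
  rewrite /H /restrict_line /mmap.
  under eq_bigr => k _ do rewrite coef_sum mulr_suml.
  rewrite exchange_big /= [RHS]big_mkcond big_seq [RHS]big_seq /=; apply: eq_bigr => m /mE ma.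
  rewrite /mmap1 /=.
  have -> : \prod_i line_coord i ^+ m i = if m 0%R == 0%N then 'X^(m i2) else 0.
    rewrite (bigD1 0)//= (bigD1 i1)//= (bigD1 i2)//=; last by rewrite i20 eq_sym.
    rewrite big1 => [|i]; last by have [->|->|->] := ord3_cover i; rewrite eqxx ?andbF.
    rewrite line_coord1 expr1n mul1r mulr1 /line_coord eqxx (negbTE i20) eq_sym (negbTE i12).
    by rewrite expr0n; case: eqP; rewrite ?mul1r ?mul0r.
  case: eqP => m0; last by rewrite big1// => k _; rewrite mulr0 coef0 mul0r.
  have m2a : (m i2 < a.+1)%N by rewrite m0 in ma; lia.
  rewrite (bigD1 (Ordinal m2a))//= big1 => [|k kn]; last first.
    rewrite coefCM coefXn; case: eqP => [E|]; last by rewrite mulr0 mul0r.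
    by case/eqP: kn; apply/val_inj.
  rewrite addr0 coefCM coefXn eqxx mulr1; congr (_ * (_ * _)); congr (_ ^+ _).
  by rewrite m0 in ma; lia.
have := Zv _ _ VP; rewrite /eval3 mevalE.
under eq_bigr => m _ do rewrite ord3_cover_prod v0 expr1n mul1r.
rewrite (bigID (fun m : 'X_{1..3} => m 0%R == 0%N)) /= -HP rP H1 => /eqP.
rewrite addr_eq0 => /eqP ->; rewrite big_filter -sumrN.
by apply: eq_bigr => m _; rewrite mulNr.
Qed.
End Restriction.

Section Finiteness.
Hypothesis no_zero : forall q : V3, q != 0 -> q 0 0 = 0 -> ~ in_closure q.

Let Y (v : V3) := v 0 0 = 1 /\ in_closure v.

Definition box_span (a b : nat) (g : V3 -> C) : Prop :=
  exists c : 'I_a -> 'I_b -> C, forall v, Y v ->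
    g v = \sum_i \sum_j c i j * (v 1 0 ^+ i * v 2 0 ^+ j).

Lemma box_span_sum a b (s : seq 'X_{1..3}) (c : 'X_{1..3} -> C) (g : 'X_{1..3} -> V3 -> C) :
  (forall m, m \in s -> box_span a b (g m)) ->
  box_span a b (fun v => \sum_(m <- s) c m * g m v).
Proof.
elim: s => [|m s IH] H.
  exists (fun _ _ => 0) => v _; rewrite big_nil big1// => i _; rewrite big1// => j _.
  by rewrite mul0r.
have [e He] := H m (mem_head _ _).
have [f Hf] := IH (fun m' m's => H m' (mem_behead (s := m :: s) m's)).
exists (fun i j => c m * e i j + f i j) => v Yv; rewrite big_cons (He v Yv) (Hf v Yv).
rewrite mulr_sumr -big_split; apply: eq_bigr => i _ /=.
by rewrite mulr_sumr -big_split; apply: eq_bigr => j _ /=; ring.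
Qed.

Lemma box_span_ext a b g h : (forall v, Y v -> g v = h v) -> box_span a b g -> box_span a b h.
Proof. by move=> gh [c Hc]; exists c => v Yv; rewrite -gh// Hc. Qed.

(** The integral equations rewrite y^a and z^b in lower total degree, so induction on p + q ends
    inside the box. *)
Lemma box_span_monomials : exists a b, [/\ (0 < a)%N, (0 < b)%N &
  forall p q, box_span a b (fun v => v 1 0 ^+ p * v 2 0 ^+ q)].
Proof.
have [a [s [c [a0 sa Ha]]]] := @integral_equation 1 2 isT isT isT no_zero.
have [b [t [e [b0 tb Hb]]]] := @integral_equation 2 1 isT isT isT no_zero.
exists a, b; split=> //.
suff H n : forall p q, (p + q < n)%N -> box_span a b (fun v => v 1 0 ^+ p * v 2 0 ^+ q).
  by move=> p q; apply: (H (p + q).+1).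
elim: n => [//|n IH] p q; rewrite ltnS => pqn.
have [ap|pa] := leqP a p.
  have E (v : V3) : Y v -> \sum_(m <- s) c m * (v 1 0 ^+ (m 1 + (p - a)) * v 2 0 ^+ (m 2%R + q)) =
      v 1 0 ^+ p * v 2 0 ^+ q.
    move=> [v0 Zv]; rewrite -{2}(subnK ap) exprD Ha// mulr_sumr mulr_suml.
    by apply: eq_bigr => m _; rewrite !exprD; ring.
  apply: box_span_ext E _; apply: box_span_sum => m /sa ms; apply: IH.
  by rewrite (leq_trans _ pqn)//; lia.
have [bq|qb] := leqP b q.
  have E (v : V3) : Y v -> \sum_(m <- t) e m * (v 1 0 ^+ (m 1 + p) * v 2 0 ^+ (m 2%R + (q - b))) =
      v 1 0 ^+ p * v 2 0 ^+ q.
    move=> [v0 Zv]; rewrite -{2}(subnK bq) exprD Hb// mulr_sumr mulr_sumr.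
    by apply: eq_bigr => m _; rewrite !exprD; ring.
  apply: box_span_ext E _; apply: box_span_sum => m /tb mt; apply: IH.
  by rewrite (leq_trans _ pqn)//; lia.
exists (fun i j => ((i == Ordinal pa) && (j == Ordinal qb))%:R) => v _.
rewrite (bigD1 (Ordinal pa))//= (bigD1 (Ordinal qb))//= !eqxx mul1r.
rewrite [X in _ = _ + X + _]big1 => [|j jq]; last by rewrite (negbTE jq) mul0r.
rewrite [X in _ = _ + X]big1 ?addr0// => i ip; rewrite big1// => j _.
by rewrite (negbTE ip) mul0r.
Qed.

(* Multiplication by g acts on the box monomials by a constant matrix, and the vector of
   their values at v is an eigenvector for the eigenvalue g v. *)
Lemma finite_values (a b : nat) (g : V3 -> C) : (0 < a)%N -> (0 < b)%N ->
  (forall p q, box_span a b (fun v => g v * (v 1 0 ^+ p * v 2 0 ^+ q))) ->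
  exists r : seq C, forall v, Y v -> g v \in r.
Proof.
move=> a0 b0 H; pose T : finType := ('I_a * 'I_b)%type.
pose f (t : T) (v : V3) := v 1 0 ^+ t.1 * v 2 0 ^+ t.2.
have /choice[c Hc] (t : T) : exists c : T -> C, forall v, Y v -> g v * f t v = \sum_u f u v * c u.
  have [c Hc] := H t.1 t.2; exists (fun u => c u.1 u.2) => v /Hc ->.
  by rewrite pair_big; apply: eq_bigr => u _; rewrite mulrC.
pose M : 'M[C]_#|T| := \matrix_(l, k) c (enum_val k) (enum_val l).
have [r Hr] := closed_field_poly_normal (char_poly M).
exists r => v Yv; rewrite -root_prod_XsubC.
have := eigenvalue_root_char M (g v).
rewrite Hr (monicP (char_poly_monic M)) scale1r => <-.
apply/eigenvalueP; exists (\row_k f (enum_val k) v).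
  apply/rowP => k; rewrite !mxE Hc// (reindex (@enum_val T T)) /=; last first.
    by apply: onW_bij; exact: enum_val_bij.
  by apply: eq_bigr => l _; rewrite !mxE.
apply/eqP => /rowP/(_ (enum_rank (Ordinal a0, Ordinal b0)))/eqP.
by rewrite !mxE enum_rankK /f /= !expr0 mulr1 oner_eq0.
Qed.

Lemma finite_points : exists r : seq (C * C), forall v, Y v -> (v 1 0, v 2 0) \in r.
Proof.
have [a [b [a0 b0 H]]] := box_span_monomials.
have [r Hr] : exists r : seq C, forall v, Y v -> v 1 0 \in r.
  apply: (finite_values a0 b0) => p q; have := H p.+1 q; apply: box_span_ext => v _.
  by rewrite exprS mulrA.
have [t Ht] : exists r : seq C, forall v, Y v -> v 2 0 \in r.
  apply: (finite_values a0 b0) => p q; have := H p q.+1; apply: box_span_ext => v _.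
  by rewrite exprS mulrCA.
exists [seq (x, y) | x <- r, y <- t] => v Yv; apply: allpairs_f; [exact: Hr|exact: Ht].
Qed.
End Finiteness.

(** Otherwise the closure has finitely many points with x_0 = 1, whereas scaling to x_0 = 1 turns
    pairwise non-proportional vectors of [X] into distinct such points. *)
Theorem closure_meets_line :
  (forall v, X v -> v 0 0 != 0) ->
  (forall N, exists f : 'I_N -> V3, (forall i, X (f i)) /\
     forall i j l, i != j -> f i <> l *: f j) ->
  exists q : V3, [/\ q != 0, q 0 0 = 0 & in_closure q].
Proof.
move=> X0 Xinf; apply: contrapT => H.
have [q q0 q00 Zq|r Hr] := @finite_points.
  by apply: H; exists q.
have [f [Xf finj]] := Xinf (size r).+1.
pose w i := (f i 0 0)^-1 *: f i.
have wY i : w i 0 0 = 1 /\ in_closure (w i).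
  split; first by rewrite mxE mulVf// X0.
  by move=> d P [hP XP]; rewrite (eval3_scale _ _ hP) XP ?mulr0.
pose h i := (w i 1 0, w i 2 0).
have hinj : injective h.
  move=> i j [h1 h2]; apply: contrapT => /eqP ij; apply: (finj i j (f i 0 0 / f j 0 0) ij).
  have fi := X0 _ (Xf i); suff E : w i = w j.
    by rewrite -scalerA -/(w j) -E scalerA divff// scale1r.
  apply/colP; apply: (@ord3_forall 0); rewrite ?add0r//.
  by rewrite (wY i).1 (wY j).1.
have : (size (map h (enum 'I_(size r).+1)) <= size r)%N.
  apply: uniq_leq_size; first by rewrite map_inj_uniq ?enum_uniq.
  by move=> _ /mapP[i _ ->]; apply: Hr; exact: wY.
by rewrite size_map size_enum_ord ltnn.
Qed.
End VanishingForms.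

(** * Periodic vectors *)

Section Triples.
Variable C : numClosedFieldType.
Local Notation V3 := 'cV[C]_3.
Local Notation M3 := 'M[C]_3.

Lemma homogeneous_comp d e (P : {mpoly C[3]}) (G : triple C) : homogeneous d P ->
  (forall i, homogeneous e (tnth G i)) -> homogeneous (d * e) (P \mPo G).
Proof.
move=> /dhomogP hP hG; rewrite /homogeneous comp_mpolyEX big_seq.
apply: rpred_sum => m mP; apply: rpredZ; rewrite comp_mpolyX.
rewrite -(hP m mP) /= mdegE big_distrl /=.
elim/big_rec2: _ => [|i n p _ hp]; first exact: dhomog1.
by apply: dhomogM => //; rewrite mulnC; apply: dhomogMn; exact: hG.
Qed.

Lemma eval3_comp (P : {mpoly C[3]}) (G : triple C) (v : V3) :
  eval3 (P \mPo G) v = eval3 P (\col_i eval3 (tnth G i) v).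
Proof. by rewrite /eval3 comp_mpoly_meval; apply: meval_eq => i; rewrite mxE. Qed.

Lemma homogeneous_linear (A : M3) i : homogeneous 1 (tnth (linear_map A) i).
Proof. by rewrite tnth_mktuple; apply: rpred_sum => j _; apply: rpredZ; exact: homogeneousX. Qed.

Lemma eval3_linear (A : M3) (v : V3) : \col_i eval3 (tnth (linear_map A) i) v = A *m v.
Proof.
apply/colP => i; rewrite !mxE tnth_mktuple /eval3 raddf_sum /=.
by apply: eq_bigr => j _; rewrite mevalZ mevalXU.
Qed.

Lemma tnth_cremona (i : 'I_3) : tnth (cremona C) i = 'X_(i + 1) * 'X_(i + 2).
Proof.
have E : (inord 0 = 0 :> 'I_3) * (inord 1 = 1 :> 'I_3) * (inord 2 = 2 :> 'I_3).
  by do !split; apply/val_inj; rewrite /= inordK.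
have E' : (1 + 1 = 2 :> 'I_3) * (1 + 2 = 0 :> 'I_3) * (2 + 1 = 0 :> 'I_3) * (2 + 2 = 1 :> 'I_3).
  by do !split; apply/val_inj.
have [->|->|->] := ord3_case 0 i; rewrite ?add0r ?E'.
- by rewrite /cremona /tnth /= !E.
- by rewrite mulrC /cremona /tnth /= !E.
- by rewrite /cremona /tnth /= !E.
Qed.

Lemma homogeneous_cremona i : homogeneous 2 (tnth (cremona C) i).
Proof. by rewrite tnth_cremona; exact: (dhomogM (homogeneousX C (i + 1)) (homogeneousX C (i + 2))). Qed.

Lemma eval3_cremona (v : V3) : \col_i eval3 (tnth (cremona C) i) v = crem v.
Proof. by apply/colP => i; rewrite !mxE tnth_cremona /eval3 mevalM !mevalXU. Qed.

Lemma tnth_comp_map (F G : triple C) i : tnth (comp_map F G) i = tnth F i \mPo G.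
Proof. by rewrite tnth_mktuple. Qed.

Definition fwd_map (A : M3) : triple C := comp_map (linear_map A) (cremona C).
Definition bwd_map (B : M3) : triple C := comp_map (cremona C) (linear_map B).

Lemma homogeneous_fwd A i : homogeneous 2 (tnth (fwd_map A) i).
Proof.
rewrite tnth_comp_map.
exact: (homogeneous_comp (homogeneous_linear A i) (@homogeneous_cremona)).
Qed.

Lemma homogeneous_bwd B i : homogeneous 2 (tnth (bwd_map B) i).
Proof.
rewrite tnth_comp_map.
exact: (homogeneous_comp (homogeneous_cremona i) (homogeneous_linear B)).
Qed.

Lemma eval3_comp_map (F G : triple C) (v : V3) :
  \col_i eval3 (tnth (comp_map F G) i) v =
  \col_i eval3 (tnth F i) (\col_j eval3 (tnth G j) v).
Proof. by apply/colP => i; rewrite !mxE tnth_comp_map eval3_comp. Qed.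

Lemma eval3_fwd (A : M3) (v : V3) : \col_i eval3 (tnth (fwd_map A) i) v = fwd A v.
Proof. by rewrite eval3_comp_map eval3_cremona eval3_linear. Qed.

Lemma eval3_bwd (B : M3) (v : V3) : \col_i eval3 (tnth (bwd_map B) i) v = bwd B v.
Proof. by rewrite eval3_comp_map eval3_linear eval3_cremona. Qed.

Lemma bwd_fwd (A : M3) (v : V3) : bwd (\adj A) (fwd A v) =
  (\det A ^+ 2 * (v 0 0 * v 1 0 * v 2 0)) *: v.
Proof.
by rewrite /bwd /fwd mulmxA mul_adj_mx mul_scalar_mx crem_scale crem_crem scalerA.
Qed.
End Triples.

(** * Invariance of the closure under the map and its inverse *)

Section PeriodicVectors.
Variable C : numClosedFieldType.
Local Notation V3 := 'cV[C]_3.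
Variable A : 'M[C]_3.

Definition torus_periodic (v : V3) : Prop :=
  exists N, [/\ (0 < N)%N, forall k, in_torus (iter k (fwd A) v) &
    exists l, iter N (fwd A) v = l *: v].

Lemma torus_periodic_fwd v : torus_periodic v -> torus_periodic (fwd A v).
Proof.
move=> [N [N0 tv [l Hl]]]; exists N; split=> //.
  by move=> k; rewrite -iterSr; exact: tv.
by exists (l ^+ 2); rewrite -iterSr iterS Hl fwd_scale.
Qed.

Lemma torus_periodic_iter k v : torus_periodic v -> torus_periodic (iter k (fwd A) v).
Proof. by move=> pv; elim: k => [//|k IH]; exact: torus_periodic_fwd. Qed.

Lemma torus_periodic_scale c v : c != 0 -> torus_periodic v -> torus_periodic (c *: v).
Proof.
move=> c0 [N [N0 tv [l Hl]]]; exists N; split=> //.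
  by move=> k i; rewrite iter_fwd_scale mxE mulf_neq0 ?expf_neq0//; exact: tv.
exists (c ^+ (2 ^ N)%N * l / c).
by rewrite iter_fwd_scale Hl !scalerA -mulrA mulVf ?mulr1.
Qed.

(** Up to a nonzero scalar, [v] is the image of [u], the vector N - 1 steps ahead in its cycle; so
    its backward image is a multiple of [u]. *)
Lemma torus_periodic_bwd v : A \in unitmx -> torus_periodic v ->
  torus_periodic (bwd (\adj A) v).
Proof.
move=> uA [N [N0 tv [l Hl]]]; pose u := iter N.-1 (fwd A) v.
have pu : torus_periodic u.
  by apply: torus_periodic_iter; exists N; split=> //; exists l.
have Fu : fwd A u = l *: v by rewrite /u -iterS prednK.
have l0 : l != 0.
  apply/eqP => l0; have := tv N 0; rewrite Hl l0 scale0r mxE eqxx.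
  by [].
have -> : v = l^-1 *: fwd A u by rewrite Fu scalerA mulVf// scale1r.
have -> : bwd (\adj A) (l^-1 *: fwd A u) = l^-1 ^+ 2 *: bwd (\adj A) (fwd A u).
  by rewrite /bwd -scalemxAr crem_scale.
rewrite bwd_fwd scalerA; apply: torus_periodic_scale => //.
have tu : in_torus u by exact: tv.
by rewrite !mulf_neq0 ?expf_neq0 ?invr_eq0// -unitfE -unitmxE.
Qed.

Lemma torus_periodic_neq0 v i : torus_periodic v -> v i 0 != 0.
Proof. by move=> [N [_ tv _]]; exact: (tv 0%N). Qed.

(** Completing the turn carries one of the two vectors to a multiple of [v] and the other to an
    iterate at a time strictly between 0 and N. *)
Lemma exact_period_distinct N v : (0 < N)%N -> exact_period A N v ->
  forall (i j : 'I_N) l, i != j -> iter i (fwd A) v <> l *: iter j (fwd A) v.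
Proof.
move=> N0 [tv [c Hc] Hex] i j l ij E.
have l0 : l != 0.
  by apply/eqP => l0; have := tv i 0; rewrite E l0 scale0r mxE eqxx.
have [lt|lt|/val_inj/eqP] := ltngtP i j; last by rewrite (negbTE ij).
- have Nji : (0 < (N - j) + i < N)%N by have := ltn_ord j; lia.
  have := congr1 (iter (N - j) (fwd A)) E.
  rewrite iter_fwd_scale -!iterD subnK ?(ltnW (ltn_ord j))// Hc scalerA.
  exact: Hex.
have Nij : (0 < (N - i) + j < N)%N by have := ltn_ord i; lia.
have := congr1 (iter (N - i) (fwd A)) E.
rewrite iter_fwd_scale -!iterD subnK ?(ltnW (ltn_ord i))// Hc => E'.
apply: (Hex _ ((l ^+ (2 ^ (N - i))%N)^-1 * c) Nij).
by rewrite -scalerA E' scalerA mulVf ?scale1r// expf_neq0.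
Qed.

Local Notation Zc := (in_closure torus_periodic).

(** A form vanishing on the periodic vectors still does so after composition with [g], which maps
    them to periodic vectors; the composite is then evaluated at [q]. *)
Lemma in_closure_comp (G : triple C) (g : V3 -> V3) e q :
  (forall i, homogeneous e (tnth G i)) -> (forall v, \col_i eval3 (tnth G i) v = g v) ->
  (forall v, torus_periodic v -> torus_periodic (g v)) -> Zc q -> Zc (g q).
Proof.
move=> hG Gg gX Zq d P [hP XP]; rewrite -Gg -eval3_comp; apply: (Zq (d * e)%N).
split=> [|v Xv]; first exact: homogeneous_comp.
by rewrite eval3_comp Gg XP//; exact: gX.
Qed.

Lemma in_closure_fwd q k : Zc q -> Zc (iter k (fwd A) q).
Proof.
move=> Zq; elim: k => [//|k IH].
exact: (in_closure_comp (homogeneous_fwd A) (eval3_fwd A) torus_periodic_fwd IH).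
Qed.

Lemma in_closure_bwd q k : A \in unitmx -> Zc q -> Zc (iter k (bwd (\adj A)) q).
Proof.
move=> uA Zq; elim: k => [//|k IH].
apply: (in_closure_comp (homogeneous_bwd (\adj A)) (eval3_bwd (\adj A)) _ IH) => v.
exact: torus_periodic_bwd.
Qed.

(** [bwd B] and [fwd B] compose the same two factors in opposite orders, so [B] carries backward
    orbits to forward ones. *)
Lemma mul_iter_bwd (B : 'M[C]_3) k (v : V3) : B *m iter k (bwd B) v = iter k (fwd B) (B *m v).
Proof. by elim: k => [//|k IH]; rewrite !iterS -IH. Qed.

Hypothesis gA : generic A.

Lemma column_notin_closure j d P : vanishing_form torus_periodic d P -> Zc (col j A) -> P = 0.
Proof.
move=> VP Zj; apply: (generic_orbit_dense gA VP.1 (j := j)) => k.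
exact: (in_closure_fwd k Zj VP).
Qed.

(** [\adj A] carries the backward orbit of e_j to the forward orbit of a column of [\adj A], a
    generic matrix. Composing the form with [A] compensates, since [A *m \adj A] is scalar. *)
Lemma vertex_notin_closure j d P : vanishing_form torus_periodic d P ->
  Zc (delta_mx j 0) -> P = 0.
Proof.
move=> VP Zj; have uA := generic_unitmx gA; pose Q := P \mPo linear_map A.
have hQ : homogeneous (d * 1) Q.
  by apply: homogeneous_comp VP.1 _; exact: homogeneous_linear.
have Q0 : Q = 0.
  apply: (generic_orbit_dense (generic_adj gA) hQ (j := j)) => k.
  rewrite colE -mul_iter_bwd eval3_comp eval3_linear mulmxA mul_mx_adj mul_scalar_mx.
  by rewrite (eval3_scale _ _ VP.1) (in_closure_bwd k uA Zj VP) mulr0.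
apply/eqP; apply: contraT => /mpoly_nonroot[v]; rewrite -[v](mulKVmx uA) -eval3_linear.
by rewrite -eval3_comp -/Q Q0 /eval3 meval0 eqxx.
Qed.
End PeriodicVectors.

Theorem torus_periodic_dense (R : realType) (A : 'M[R[i]]_3) d (P : {mpoly R[i][3]}) :
  generic A -> homogeneous d P ->
  (forall v, torus_periodic A v -> eval3 P v = 0) -> P = 0.
Proof.
move=> gA hP XP; have VP : vanishing_form (torus_periodic A) d P by [].
have [||q [q0 q00 Zq]] := @closure_meets_line _ (torus_periodic A).
- by move=> v; exact: torus_periodic_neq0.
- move=> [|N]; first by exists (fun=> 0); split=> -[].
  have [v Hv] := generic_exact_period (ltn0Sn N) gA.
  exists (fun i : 'I_N.+1 => iter i (fwd A) v); split; last first.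
    by move=> i j l; exact: exact_period_distinct.
  have [tv lv _] := Hv; move=> i.
  by apply: torus_periodic_iter; exists N.+1; split.
(* At a vertex [fwd A] is zero and gives no information, hence the backward orbit there; elsewhere
   on x_0 = 0 the image is a nonzero multiple of column 0. *)
have [q1|q1] := eqVneq (q 1 0) 0.
  have q2 : q 2 0 != 0.
    apply: contraNneq q0 => q2; apply/eqP/colP; apply: (@ord3_forall 0);
      by rewrite ?add0r mxE.
  apply: (vertex_notin_closure gA VP (j := 2)); apply: in_closure_scale q2 _.
  suff -> : q 2 0 *: delta_mx 2 0 = q by [].
  by apply/colP; apply: (@ord3_forall 0); rewrite ?add0r !mxE /= ?mulr0 ?mulr1.
have [q2|q2] := eqVneq (q 2 0) 0.
  apply: (vertex_notin_closure gA VP (j := 1)); apply: in_closure_scale q1 _.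
  suff -> : q 1 0 *: delta_mx 1 0 = q by [].
  by apply/colP; apply: (@ord3_forall 0); rewrite ?add0r !mxE /= ?mulr0 ?mulr1.
apply: (column_notin_closure gA VP (j := 0)).
apply: (@in_closure_scale _ _ (q 1 0 * q 2 0)); first by rewrite mulf_neq0.
suff -> : (q 1 0 * q 2 0) *: col 0 A = fwd A q by exact: (in_closure_fwd 1 Zq).
apply/colP => i; rewrite (fwd_coord _ _ 0) !mxE ?add0r q00 !(mulr0, mul0r, addr0).
by rewrite mulrC.
Qed.

(** * Periodic points of the plane *)

Local Open Scope classical_set_scope.

Section PeriodicPoints.
Variable C : numClosedFieldType.
Local Notation V3 := 'cV[C]_3.

Lemma eval3_inj (P Q : {mpoly C[3]}) : (forall v, eval3 P v = eval3 Q v) -> P = Q.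
Proof.
move=> PQ; apply/eqP; rewrite -subr_eq0; apply: contraT => /mpoly_nonroot[v].
by rewrite /eval3 mevalB -![_.@[_]]/(eval3 _ v) PQ subrr eqxx.
Qed.

Lemma rational_map_eval d (F : triple C) (v : V3) : (forall i, homogeneous d (tnth F i)) ->
  \col_i eval3 (tnth F i) v != 0 -> rational_map F.
Proof.
move=> hF Fv; split; first by exists d.
apply: contrapT => F0; case/eqP: Fv; apply/colP => i; rewrite !mxE.
have -> : tnth F i = 0 by apply: contrapT => /eqP Fi; apply: F0; exists i.
by rewrite /eval3 meval0.
Qed.

Lemma same_map_id (F : triple C) (s : V3 -> C) :
  (forall v, \col_i eval3 (tnth F i) v = s v *: v) -> same_map F (id_map C).
Proof.
move=> Fs i j; apply: eval3_inj => v; rewrite !tnth_mktuple /eval3 !mevalM !mevalXU.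
have E k : eval3 (tnth F k) v = s v * v k 0.
  by have /colP/(_ k) := Fs v; rewrite !mxE.
by rewrite -![(tnth F _).@[_]]/(eval3 _ v) !E; ring.
Qed.

Lemma eval3_iter_map n (F : triple C) g : (forall v, \col_i eval3 (tnth F i) v = g v) ->
  forall v, \col_i eval3 (tnth (iter_map n F) i) v = iter n g v.
Proof.
move=> Fg; elim: n => [|n IH] v; last by rewrite /iter_map iterS eval3_comp_map IH Fg.
by apply/colP => i; rewrite !mxE tnth_mktuple /eval3 mevalXU.
Qed.

Lemma fwd_bwd (A : 'M[C]_3) v : exists s, fwd A (bwd (\adj A) v) = s *: v.
Proof.
rewrite /fwd /bwd crem_crem -scalemxAr mulmxA mul_mx_adj mul_scalar_mx scalerA.
by eexists.
Qed.

Lemma inverse_maps_fwd_bwd (A : 'M[C]_3) : A \in unitmx ->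
  inverse_maps (fwd_map A) (bwd_map (\adj A)).
Proof.
move=> uA; pose u : V3 := const_mx 1.
have u0 : u != 0.
  by apply/eqP => /colP/(_ 0)/eqP; rewrite !mxE oner_eq0.
have cu : crem u = u by apply/colP => i; rewrite !mxE mulr1.
have Fu : fwd A u != 0.
  apply: contraNneq u0; rewrite /fwd cu => /(congr1 (mulmx (invmx A))).
  by rewrite mulKmx// mulmx0 => ->.
have d0 : \det A != 0 by rewrite -unitfE -unitmxE.
have Gu : bwd (\adj A) (A *m u) != 0.
  rewrite /bwd mulmxA mul_adj_mx mul_scalar_mx crem_scale cu.
  by rewrite scaler_eq0 expf_eq0 (negbTE d0).
have GFu : bwd (\adj A) (fwd A u) != 0.
  by rewrite /fwd cu.
have FGu : fwd A (bwd (\adj A) (A *m u)) != 0.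
  rewrite /bwd mulmxA mul_adj_mx mul_scalar_mx crem_scale cu fwd_scale.
  by rewrite scaler_eq0 !expf_eq0 (negbTE d0).
have hF := @homogeneous_fwd _ A; have hG := @homogeneous_bwd _ (\adj A).
split.
- by apply: (rational_map_eval (v := u) hF); rewrite eval3_fwd.
- by apply: (rational_map_eval (v := A *m u) hG); rewrite eval3_bwd.
- split.
    apply: (@rational_map_eval (2 * 2) _ (A *m u)) => [i|].
      by rewrite tnth_comp_map; apply: homogeneous_comp.
    by rewrite eval3_comp_map eval3_bwd eval3_fwd.
  have /choice[s Hs] v := fwd_bwd A v.
  by apply: (same_map_id (s := s)) => v; rewrite eval3_comp_map eval3_bwd eval3_fwd.
- split.
    apply: (@rational_map_eval (2 * 2) _ u) => [i|].
      by rewrite tnth_comp_map; apply: homogeneous_comp.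
    by rewrite eval3_comp_map eval3_fwd eval3_bwd.
  apply: (same_map_id (s := fun v => \det A ^+ 2 * (v 0 0 * v 1 0 * v 2%:R 0))) => v.
  by rewrite eval3_comp_map eval3_fwd eval3_bwd bwd_fwd.
Qed.

Lemma line_subproof (w : V3) : w != 0 -> \dim <[w]>%VS == 1%N.
Proof. by move=> w0; rewrite dim_vline w0. Qed.

Definition line (w : V3) (w0 : w != 0) : P2 C := exist _ <[w]>%VS (line_subproof w0).

Lemma hcoord_line w w0 : hcoord (@line w w0) w.
Proof. by split=> //; exact: memv_line. Qed.

Lemma line_scale w w' w0 w0' c : w = c *: w' -> @line w w0 = @line w' w0'.
Proof.
move=> E; apply: val_inj => /=; rewrite E.
have c0 : c != 0 by apply: contraNneq w0 => c0; rewrite E c0 scale0r.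
apply/eqP; rewrite eqEsubv -!memvE memvZ ?memv_line//=.
by rewrite -[X in X \in _](scalerK c0) memvZ// memv_line.
Qed.

Lemma differentiable_fwd (A : 'M[C]_3) (w : V3) : differentiable (fwd A) w.
Proof.
have -> : fwd A = \sum_(k < 3) (fun u : V3 => (u (k + 1) 0 * u (k + 2) 0) *: col k A).
  apply/funext => u; rewrite fct_sumE; apply/colP => i; rewrite !mxE summxE.
  by apply: eq_bigr => k _; rewrite !mxE mulrC.
apply: differentiable_sum => k.
apply: differentiableZl; apply: differentiableM; exact: differentiable_coord.
Qed.

Lemma differentiable_iter_fwd (A : 'M[C]_3) n (w : V3) : differentiable (iter n (fwd A)) w.
Proof.
elim: n w => [|n IH] w; first exact: ex_diff.
by apply: (differentiable_comp (IH w)); exact: differentiable_fwd.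
Qed.

(** The polynomial lift of each iterate serves as the holomorphic germ, being nonzero at [v]. The
    triples of the map and its inverse do not vanish along the orbit either, which keeps it off both
    indeterminacy sets. *)
Theorem torus_periodic_point (A : 'M[C]_3) (v : V3) (v0 : v != 0) : A \in unitmx ->
  torus_periodic A v -> periodic_point (fwd_map A) (line v0).
Proof.
move=> uA [N [N0 tv [l Hl]]]; exists (bwd_map (\adj A)); first exact: inverse_maps_fwd_bwd.
pose w n := iter n (fwd A) v.
have w0 n : w n != 0.
  by apply: contraTneq (tv n 0) => wn; rewrite -/(w n) wn mxE eqxx.
exists (fun n => line (w0 n)); split.
- move=> n; exists v, (iter n (fwd A)); split.
  + exact: hcoord_line.
  + exact: hcoord_line.
  + by near=> u; exact: differentiable_iter_fwd.
  + near=> u => i j; have /colP E := eval3_iter_map n (@eval3_fwd _ A) u.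
    by rewrite -!E !mxE mulrC.
- apply: (@sub_finite_set _ _ ((fun n => line (w0 n)) @` `I_N)); last first.
    exact/finite_image/finite_II.
  move=> _ [n _ <-]; exists (n %% N)%N; first by rewrite /= ltn_mod.
  have [c E] : exists c, w n = c *: w (n %% N)%N.
    rewrite {1}(divn_eq n N); elim: (n %/ N)%N => [|q [c IH]].
      by exists 1; rewrite mul0n add0n scale1r.
    exists (l ^+ (2 ^ (q * N + n %% N))%N * c).
    by rewrite mulSn -addnA addnC /w iterD Hl iter_fwd_scale -/(w _) IH scalerA.
  by apply/esym/(line_scale _ _ E).
- apply/seteqP; split=> // p [[n _ <-] []] H.
    have /eqP := w0 n.+1; apply; apply/colP => i; rewrite [RHS]mxE.
    rewrite /w iterS -eval3_fwd mxE.
    apply: (H (fwd_map A)); last exact: hcoord_line.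
      by case: (inverse_maps_fwd_bwd uA).
    by move=> a b; rewrite mulrC.
  have H' : bwd (\adj A) (w n) = 0.
    apply/colP => i; rewrite [RHS]mxE -eval3_bwd mxE.
    apply: (H (bwd_map (\adj A))); last exact: hcoord_line.
      by case: (inverse_maps_fwd_bwd uA).
    by move=> a b; rewrite mulrC.
  have pw : torus_periodic A (w n).
    by apply: torus_periodic_iter; exists N; split=> //; exists l.
  have := torus_periodic_neq0 0 (torus_periodic_bwd uA pw).
  by rewrite H' mxE eqxx.
Unshelve. all: by end_near.
Qed.
End PeriodicPoints.

(** Independence is assumed for a multiple of [A] only; the iterates for the two matrices differ by
    nonzero scalars. *)
Lemma torus_periodic_scalel (C : numClosedFieldType) (A : 'M[C]_3) c v : c != 0 ->
  torus_periodic (c *: A) v -> torus_periodic A v.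
Proof.
move=> c0 [N [N0 tv [l Hl]]].
have E k : exists2 d, d != 0 & iter k (fwd (c *: A)) v = d *: iter k (fwd A) v.
  elim: k => [|k [d d0 IH]]; first by exists 1; rewrite ?oner_eq0// scale1r.
  exists (c * d ^+ 2); first by rewrite mulf_neq0// expf_neq0.
  by rewrite !iterS IH fwd_scalel fwd_scale scalerA.
exists N; split=> //.
  move=> k i; have [d d0 Ek] := E k; have := tv k i.
  by rewrite Ek mxE mulf_eq0 negb_or => /andP[].
have [d d0 EN] := E N; exists (d^-1 * l).
by rewrite -scalerA -Hl EN scalerA mulVf// scale1r.
Qed.

Theorem mainTheorem11 (R : realType) (A : 'M[R[i]]_3) :
  A \in unitmx ->
  alg_indep_coefficients A ->
  zariski_dense
    [set p : P2 R[i] | periodic_point (comp_map (linear_map A) (cremona R[i])) p].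
Proof.
move=> uA [c c0 iA] Z [S hS ->] sub.
have gA := alg_indep_generic iA.
apply/seteqP; split=> // p _ F SF v hv; have [d hF] := hS F SF.
suff -> : F = 0 by rewrite /eval3 meval0.
apply: (torus_periodic_dense gA hF) => w pw.
have pAw := torus_periodic_scalel c0 pw.
have w0 : w != 0.
  by apply: contraTneq (torus_periodic_neq0 0 pw) => ->; rewrite mxE eqxx.
exact: (sub _ (torus_periodic_point w0 uA pAw) F SF w (hcoord_line w0)).
Qed.
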